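(* Let $\mathfrak{A}$ be a unital $\mathrm{C}^*$-algebra, let $\mathfrak{S}\subset\mathfrak{A}$ be an operator system and let $\psi$ be a state on $\mathfrak{A}$. The following are equivalent: (i) $\psi$ is $\mathfrak{S}$-peaking; (ii) $\psi$ has the unique extension property with respect to $\mathfrak{S}$, and the restriction $\psi|_{\mathfrak{S}}$ is a weak-$*$ exposed point of the set $Q$ of self-adjoint linear functionals on $\mathfrak{S}$ of norm at most $1$.
   Context: An operator system $\mathfrak{S}\subset\mathfrak{A}$ is a unital self-adjoint subspace. A state $\psi$ on $\mathfrak{A}$ is $\mathfrak{S}$-peaking if there is a self-adjoint $s\in\mathfrak{S}$ with $\|s\|=1$ such that $\psi(s)=1>|\phi(s)|$ for every state $\phi$ on $\mathfrak{A}$ with $\phi\neq\psi$. A state $\psi$ on $\mathfrak{A}$ has the unique extension property with respect to $\mathfrak{S}$ if it is the unique unital completely positive map on $\mathfrak{A}$ extending $\psi|_{\mathfrak{S}}$. For a normed space $X$ and a weak-$*$ closed convex set $Q$ in the closed unit ball of $X^*$ containing $0$, a nonzero $\Lambda_0\in Q$ is a weak-$*$ exposed point of $Q$ if there is $x_0\in X$ with $\operatorname{Re}\Lambda_0(x_0)=1>\operatorname{Re}\Lambda(x_0)$ for all $\Lambda\in Q$ with $\Lambda\neq\Lambda_0$. A functional $\Lambda$ on $\mathfrak{S}$ is self-adjoint if $\Lambda(s^* )=\overline{\Lambda(s)}$ for all $s\in\mathfrak{S}$. *)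

(* Defs.v *)
From Stdlib Require Import Reals.
Open Scope R_scope.

Record Cplx := mkC { Cre : R; Cim : R }.
Definition C0 : Cplx := mkC 0 0.
Definition C1 : Cplx := mkC 1 0.
Definition Cadd (z w : Cplx) : Cplx := mkC (Cre z + Cre w) (Cim z + Cim w).
Definition Copp (z : Cplx) : Cplx := mkC (- Cre z) (- Cim z).
Definition Cmul (z w : Cplx) : Cplx :=
  mkC (Cre z * Cre w - Cim z * Cim w) (Cre z * Cim w + Cim z * Cre w).
Definition Cconj (z : Cplx) : Cplx := mkC (Cre z) (- Cim z).
Definition Cabs (z : Cplx) : R := sqrt (Cre z * Cre z + Cim z * Cim z).

Fixpoint csum (n : nat) (f : nat -> Cplx) : Cplx :=
  match n with O => C0 | S k => Cadd (csum k f) (f k) end.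

Record CStarAlgebra := {
  car :> Type;
  zero : car;
  add : car -> car -> car;
  opp : car -> car;
  smul : Cplx -> car -> car;
  mul : car -> car -> car;
  one : car;
  star : car -> car;
  norm : car -> R;
  addA : forall x y z, add x (add y z) = add (add x y) z;
  addC : forall x y, add x y = add y x;
  add0 : forall x, add zero x = x;
  addN : forall x, add x (opp x) = zero;
  smulA : forall a b x, smul a (smul b x) = smul (Cmul a b) x;
  smul1 : forall x, smul C1 x = x;
  smulDr : forall a x y, smul a (add x y) = add (smul a x) (smul a y);
  smulDl : forall a b x, smul (Cadd a b) x = add (smul a x) (smul b x);
  mulA : forall x y z, mul x (mul y z) = mul (mul x y) z;
  mulDl : forall x y z, mul (add x y) z = add (mul x z) (mul y z);
  mulDr : forall x y z, mul x (add y z) = add (mul x y) (mul x z);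
  mulZl : forall a x y, mul (smul a x) y = smul a (mul x y);
  mulZr : forall a x y, mul x (smul a y) = smul a (mul x y);
  mul1l : forall x, mul one x = x;
  mul1r : forall x, mul x one = x;
  starD : forall x y, star (add x y) = add (star x) (star y);
  starZ : forall a x, star (smul a x) = smul (Cconj a) (star x);
  starM : forall x y, star (mul x y) = mul (star y) (star x);
  starK : forall x, star (star x) = x;
  norm_ge0 : forall x, 0 <= norm x;
  norm_eq0 : forall x, norm x = 0 -> x = zero;
  norm_triangle : forall x y, norm (add x y) <= norm x + norm y;
  normZ : forall a x, norm (smul a x) = Cabs a * norm x;
  normM : forall x y, norm (mul x y) <= norm x * norm y;
  norm_Cstar : forall x, norm (mul (star x) x) = norm x * norm x;
  complete : forall u : nat -> car,
    (forall eps, 0 < eps -> exists N, forall m n, (N <= m)%nat -> (N <= n)%nat ->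
        norm (add (u m) (opp (u n))) < eps) ->
    exists l, forall eps, 0 < eps -> exists N, forall n, (N <= n)%nat ->
        norm (add (u n) (opp l)) < eps
}.

Arguments zero {_}. Arguments add {_}. Arguments opp {_}. Arguments smul {_}.
Arguments mul {_}. Arguments one {_}. Arguments star {_}. Arguments norm {_}.

Section Notions.
Variable A : CStarAlgebra.

Definition invertible (x : A) : Prop :=
  exists y : A, mul x y = one /\ mul y x = one.

Definition positive (a : A) : Prop :=
  star a = a /\
  forall l : Cplx, ~ invertible (add a (smul (Copp l) one)) -> Cim l = 0 /\ 0 <= Cre l.

(* ---- n x n matrices over A (entries outside 0..n-1 are ignored) ---- *)
Fixpoint asum (n : nat) (f : nat -> A) : A :=
  match n with O => zero | S k => add (asum k f) (f k) end.
Definition mat := nat -> nat -> A.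
Definition meq (n : nat) (X Y : mat) : Prop :=
  forall i j, (i < n)%nat -> (j < n)%nat -> X i j = Y i j.
Definition mmul (n : nat) (X Y : mat) : mat :=
  fun i j => asum n (fun k => mul (X i k) (Y k j)).
Definition mstar (X : mat) : mat := fun i j => star (X j i).
Definition mid : mat := fun i j => if Nat.eqb i j then one else zero.
Definition minvertible (n : nat) (X : mat) : Prop :=
  exists Y, meq n (mmul n X Y) mid /\ meq n (mmul n Y X) mid.
Definition mpositive (n : nat) (X : mat) : Prop :=
  meq n (mstar X) X /\
  forall l : Cplx, ~ minvertible n (fun i j => add (X i j) (smul (Copp l) (mid i j))) ->
     Cim l = 0 /\ 0 <= Cre l.

Definition linear (f : A -> Cplx) : Prop :=
  (forall x y, f (add x y) = Cadd (f x) (f y)) /\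
  (forall a x, f (smul a x) = Cmul a (f x)).

Definition state (f : A -> Cplx) : Prop :=
  linear f /\ f one = C1 /\
  (forall a, positive a -> Cim (f a) = 0 /\ 0 <= Cre (f a)).

Definition completely_positive (f : A -> Cplx) : Prop :=
  forall (n : nat) (X : mat), mpositive n X ->
  forall v : nat -> Cplx,
    let z := csum n (fun i => csum n (fun j =>
                 Cmul (Cconj (v i)) (Cmul (f (X i j)) (v j)))) in
    Cim z = 0 /\ 0 <= Cre z.

Definition ucp (f : A -> Cplx) : Prop :=
  linear f /\ f one = C1 /\ completely_positive f.

Definition operator_system (S : A -> Prop) : Prop :=
  S one /\
  (forall x y, S x -> S y -> S (add x y)) /\
  (forall a x, S x -> S (smul a x)) /\
  (forall x, S x -> S (star x)).

Definition S_peaking (S : A -> Prop) (psi : A -> Cplx) : Prop :=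
  exists s, S s /\ star s = s /\ norm s = 1 /\ psi s = C1 /\
    forall phi, state phi -> (exists a, phi a <> psi a) -> Cabs (phi s) < 1.

Definition unique_extension_property (S : A -> Prop) (psi : A -> Cplx) : Prop :=
  ucp psi /\
  forall Phi, ucp Phi -> (forall s, S s -> Phi s = psi s) -> forall a, Phi a = psi a.

(* ---- functionals on S (only their values on S matter) ---- *)
Definition funct_eq_on (S : A -> Prop) (L M : A -> Cplx) : Prop :=
  forall s, S s -> L s = M s.

(* Q: self-adjoint linear functionals on S of norm at most 1
   (||L|| <= 1 unfolded as |L s| <= ||s|| for all s in S) *)
Definition Q_sa_ball (S : A -> Prop) (L : A -> Cplx) : Prop :=
  (forall x y, S x -> S y -> L (add x y) = Cadd (L x) (L y)) /\
  (forall a x, S x -> L (smul a x) = Cmul a (L x)) /\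
  (forall x, S x -> L (star x) = Cconj (L x)) /\
  (forall x, S x -> Cabs (L x) <= norm x).

Definition weak_star_exposed (S : A -> Prop) (Q : (A -> Cplx) -> Prop) (L0 : A -> Cplx) : Prop :=
  Q L0 /\ (exists s, S s /\ L0 s <> C0) /\
  exists x0, S x0 /\ Cre (L0 x0) = 1 /\
    forall L, Q L -> ~ funct_eq_on S L L0 -> Cre (L x0) < 1.

End Notions.

(* Main.v *)
From Stdlib Require Import Reals Lra Lia List Classical.
From mathcomp Require classical_sets.
Require Import Defs.
Import ListNotations.

(** An element is strictly positive when it is self-adjoint and at distance less than [t]
    from some scalar [t]; these elements have self-adjoint square roots by a contraction
    argument, and this gives the usual order theory of a C*-algebra (positivity of
    [x^2] and of [b* b], agreement with the spectral definition, and
    [-t <= x <= t -> |x| <= t]) without spectral radii. It follows that states are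
    completely positive, so that unital completely positive functionals and states are
    the same thing.

    If [psi] peaks at [s], a hermitian functional [L] in the unit ball of [S*] with
    [L s = 1] extends, by Hahn-Banach, to a difference [F1 - F2] of positive functionals
    with [F1 1 + F2 1 <= 1]. Then [F1] and [-F2] must attain their norms at [s], so that
    [F2 = 0] and [F1 = psi]. Conversely, the real part [s] of an exposing element has
    norm one by Hahn-Banach, and a state [phi] other than [psi] differs from [psi] on [S]
    by the unique extension property, so exposedness applied to [phi] and to [- phi]
    gives [|phi s| < 1]. *)

Declare Scope cstar_scope.
Delimit Scope cstar_scope with cs.
Notation "x + y" := (add x y) : cstar_scope.
Notation "x * y" := (mul x y) : cstar_scope.
Notation "- x" := (opp x) : cstar_scope.
Notation "x - y" := (add x (opp y)) : cstar_scope.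
Arguments norm {_} _%_cs.
Arguments star {_} _%_cs.
Arguments smul {_} _ _%_cs.
Arguments opp {_} _%_cs.
Arguments add {_} _%_cs _%_cs.
Arguments mul {_} _%_cs _%_cs.

(** * Complex scalars *)

Definition rc (r : R) : Cplx := mkC r 0.
Definition Ci : Cplx := mkC 0 1.
Notation "r *: x" := (smul (rc r) x)
  (at level 40, left associativity) : cstar_scope.

Lemma Cplx_ext (z w : Cplx) : Cre z = Cre w -> Cim z = Cim w -> z = w.
Proof. destruct z, w; cbn; intros -> ->; reflexivity. Qed.

Ltac real_arith :=
  first [ring | lra | nra | field; lra | field; nra | field].

Ltac cplx_arith :=
  apply Cplx_ext;
  cbn [Cre Cim Cadd Cmul Copp Cconj C0 C1 rc Ci]; real_arith.

Lemma Cabs_ge0 z : 0 <= Cabs z.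
Proof. apply sqrt_pos. Qed.

Lemma Cabs_sqr z : Cabs z * Cabs z = Cre z * Cre z + Cim z * Cim z.
Proof. apply sqrt_sqrt; nra. Qed.

Lemma Cabs_rc r : Cabs (rc r) = Rabs r.
Proof.
  unfold Cabs; cbn. rewrite Rmult_0_l, Rplus_0_r. apply sqrt_Rsqr_abs.
Qed.

Lemma Cre_le_Cabs z : Rabs (Cre z) <= Cabs z.
Proof.
  pose proof (Cabs_ge0 z). pose proof (Cabs_sqr z).
  apply Rabs_le. split; nra.
Qed.

(** * Normalisation of noncommutative polynomial identities *)

Inductive ncexp :=
| NVar (n : nat) | NZero | NOne | NAdd (e f : ncexp) | NOpp (e : ncexp)
| NMul (e f : ncexp) | NScal (c : Cplx) (e : ncexp).

(** A linear combination of words in the variables, the empty word standing for [one]. Equal words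
    are merged on insertion, but vanishing terms stay, since equality of coefficients cannot be
    computed. *)
Definition ncpoly := list (list nat * Cplx).

Fixpoint mono_eqb (m p : list nat) : bool :=
  match m, p with
  | [], [] => true
  | i :: m', j :: p' => if Nat.eqb i j then mono_eqb m' p' else false
  | _, _ => false
  end.

Fixpoint nc_insert (m : list nat) (c : Cplx) (p : ncpoly) : ncpoly :=
  match p with
  | [] => [(m, c)]
  | (m', c') :: p' =>
      if mono_eqb m m' then (m', Cadd c c') :: p' else (m', c') :: nc_insert m c p'
  end.

Fixpoint nc_add (p q : ncpoly) : ncpoly :=
  match p with
  | [] => q
  | (m, c) :: p' => nc_insert m c (nc_add p' q)
  end.

Fixpoint nc_scal (c : Cplx) (p : ncpoly) : ncpoly :=
  match p with
  | [] => []
  | (m, d) :: p' => (m, Cmul c d) :: nc_scal c p'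
  end.

Fixpoint nc_mulmono (m : list nat) (c : Cplx) (p : ncpoly) : ncpoly :=
  match p with
  | [] => []
  | (m', d) :: p' => (m ++ m', Cmul c d) :: nc_mulmono m c p'
  end.

Fixpoint nc_mul (p q : ncpoly) : ncpoly :=
  match p with
  | [] => []
  | (m, c) :: p' => nc_add (nc_mulmono m c q) (nc_mul p' q)
  end.

Fixpoint nc_norm (e : ncexp) : ncpoly :=
  match e with
  | NVar n => [([n], C1)]
  | NZero => []
  | NOne => [([], C1)]
  | NAdd e f => nc_add (nc_norm e) (nc_norm f)
  | NOpp e => nc_scal (Copp C1) (nc_norm e)
  | NMul e f => nc_mul (nc_norm e) (nc_norm f)
  | NScal c e => nc_scal c (nc_norm e)
  end.

Fixpoint nc_null (p : ncpoly) : Prop :=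
  match p with
  | [] => True
  | (_, c) :: p' => c = C0 /\ nc_null p'
  end.

Section Vector.
Context {A : CStarAlgebra}.
Implicit Types x y z : A.
Local Open Scope cstar_scope.

Lemma addx0 x : x + zero = x.
Proof. rewrite addC; apply add0. Qed.

Lemma add_cancel x y z : x + y = x + z -> y = z.
Proof.
  intros H. rewrite <- (add0 A y), <- (add0 A z), <- (addN A x), (addC A x).
  rewrite <- !addA, H. reflexivity.
Qed.

Lemma smul0l x : smul C0 x = zero.
Proof.
  apply add_cancel with (smul C0 x). rewrite <- smulDl, addx0.
  f_equal; cplx_arith.
Qed.

Lemma opp_smul x : - x = smul (Copp C1) x.
Proof.
  apply add_cancel with x. rewrite addN.
  rewrite <- (smul1 A x) at 1. rewrite <- smulDl, <- (smul0l x).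
  f_equal; cplx_arith.
Qed.

Lemma smul0r c : smul c (zero : A) = zero.
Proof.
  rewrite <- (smul0l zero), smulA. f_equal; cplx_arith.
Qed.

Lemma mul0l x : zero * x = zero.
Proof. rewrite <- (smul0l zero) at 1. rewrite mulZl; apply smul0l. Qed.

Lemma mul0r x : x * zero = zero.
Proof. rewrite <- (smul0l zero) at 1. rewrite mulZr; apply smul0l. Qed.

Lemma sub_eq0 x y : x - y = zero -> x = y.
Proof.
  intros H. apply add_cancel with (- y).
  rewrite addC, H, addC, addN; reflexivity.
Qed.

Variable env : list A.

Fixpoint nc_eval (e : ncexp) : A :=
  match e with
  | NVar n => nth n env zero
  | NZero => zero
  | NOne => one
  | NAdd e f => nc_eval e + nc_eval f
  | NOpp e => - nc_eval e
  | NMul e f => nc_eval e * nc_eval f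
  | NScal c e => smul c (nc_eval e)
  end.

Fixpoint mono_eval (m : list nat) : A :=
  match m with
  | [] => one
  | n :: m' => nth n env zero * mono_eval m'
  end.

Fixpoint poly_eval (p : ncpoly) : A :=
  match p with
  | [] => zero
  | (m, c) :: p' => smul c (mono_eval m) + poly_eval p'
  end.

Lemma mono_eqb_eq m p : mono_eqb m p = true -> m = p.
Proof.
  revert p; induction m as [|i m IH]; intros [|j p]; cbn; try easy.
  destruct (Nat.eqb i j) eqn:E; try easy. apply Nat.eqb_eq in E. intros H.
  rewrite E, (IH p H); reflexivity.
Qed.

Lemma nc_insert_eval m c p :
  poly_eval (nc_insert m c p) = smul c (mono_eval m) + poly_eval p.
Proof.
  induction p as [|[m' c'] p IH]; cbn; [reflexivity|].
  destruct (mono_eqb m m') eqn:E; cbn.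
  - apply mono_eqb_eq in E; subst. rewrite smulDl, addA; reflexivity.
  - rewrite IH, !addA. f_equal. apply addC.
Qed.

Lemma nc_add_eval p q : poly_eval (nc_add p q) = poly_eval p + poly_eval q.
Proof.
  induction p as [|[m c] p IH]; cbn.
  - rewrite add0; reflexivity.
  - rewrite nc_insert_eval, IH, addA; reflexivity.
Qed.

Lemma nc_scal_eval c p : poly_eval (nc_scal c p) = smul c (poly_eval p).
Proof.
  induction p as [|[m d] p IH]; cbn.
  - rewrite smul0r; reflexivity.
  - rewrite IH, smulDr, smulA; reflexivity.
Qed.

Lemma mono_eval_app m p : mono_eval (m ++ p) = mono_eval m * mono_eval p.
Proof.
  induction m as [|i m IH]; cbn.
  - rewrite mul1l; reflexivity.
  - rewrite IH, mulA; reflexivity.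
Qed.

Lemma nc_mulmono_eval m c p :
  poly_eval (nc_mulmono m c p) = smul c (mono_eval m) * poly_eval p.
Proof.
  induction p as [|[m' d] p IH]; cbn.
  - rewrite mul0r; reflexivity.
  - rewrite IH, mulDr, mono_eval_app, mulZr, (mulZl A c (mono_eval m) (mono_eval m')), smulA.
    do 2 f_equal. cplx_arith.
Qed.

Lemma nc_mul_eval p q : poly_eval (nc_mul p q) = poly_eval p * poly_eval q.
Proof.
  induction p as [|[m c] p IH]; cbn.
  - rewrite mul0l; reflexivity.
  - rewrite nc_add_eval, nc_mulmono_eval, IH, mulDl; reflexivity.
Qed.

Lemma nc_norm_eval e : poly_eval (nc_norm e) = nc_eval e.
Proof.
  induction e; cbn.
  - rewrite smul1, addx0, mul1r; reflexivity.
  - reflexivity.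
  - rewrite smul1, addx0; reflexivity.
  - rewrite nc_add_eval, IHe1, IHe2; reflexivity.
  - rewrite nc_scal_eval, IHe, opp_smul; reflexivity.
  - rewrite nc_mul_eval, IHe1, IHe2; reflexivity.
  - rewrite nc_scal_eval, IHe; reflexivity.
Qed.

Lemma nc_null_eval p : nc_null p -> poly_eval p = zero.
Proof.
  induction p as [|[m c] p IH]; cbn; [reflexivity|].
  intros [-> H]. rewrite smul0l, IH, add0 by exact H. reflexivity.
Qed.

(** After normalisation of the difference, what remains to prove is a list of identities between
    complex coefficients. *)
Lemma nc_correct e f :
  nc_null (nc_norm (NAdd e (NOpp f))) -> nc_eval e = nc_eval f.
Proof.
  intros H. apply nc_null_eval in H. rewrite nc_norm_eval in H.
  apply sub_eq0. exact H.
Qed.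

End Vector.

Ltac nc_vars e l :=
  lazymatch e with
  | add ?a ?b => let l1 := nc_vars a l in nc_vars b l1
  | mul ?a ?b => let l1 := nc_vars a l in nc_vars b l1
  | opp ?a => nc_vars a l
  | smul _ ?a => nc_vars a l
  | zero => l
  | one => l
  | _ => lazymatch l with
         | context [cons e _] => l
         | _ => constr:(cons e l)
         end
  end.

Ltac nc_index e l :=
  lazymatch l with
  | cons e _ => constr:(O)
  | cons _ ?l' => let n := nc_index e l' in constr:(S n)
  end.

Ltac nc_reify e l :=
  lazymatch e with
  | add ?a ?b => let a' := nc_reify a l in let b' := nc_reify b l in constr:(NAdd a' b')
  | mul ?a ?b => let a' := nc_reify a l in let b' := nc_reify b l in constr:(NMul a' b')
  | opp ?a => let a' := nc_reify a l in constr:(NOpp a')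
  | smul ?c ?a => let a' := nc_reify a l in constr:(NScal c a')
  | zero => constr:(NZero)
  | one => constr:(NOne)
  | _ => let n := nc_index e l in constr:(NVar n)
  end.

Ltac nc :=
  lazymatch goal with
  | |- @eq ?T ?x ?y =>
      let T' := eval cbn in T in
      lazymatch T' with car ?A =>
      let l0 := nc_vars x (@nil (car A)) in
      let l := nc_vars y l0 in
      let e := nc_reify x l in
      let f := nc_reify y l in
      change (nc_eval l e = nc_eval l f);
      apply nc_correct;
      cbv [nc_norm nc_add nc_insert nc_scal nc_mulmono nc_mul nc_null
           mono_eqb Nat.eqb app];
      repeat split; cplx_arith
      end
  end.

(** * Elementary norm and involution facts *)

Section Elementary.
Context {A : CStarAlgebra}.
Implicit Types x y z : A.
Local Open Scope cstar_scope.

Lemma star_one : star (one : A) = one.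
Proof.
  rewrite <- (mul1l A (star one)). rewrite <- (starK A one) at 1.
  rewrite <- starM, mul1l, starK; reflexivity.
Qed.

Lemma star_opp x : star (- x) = - star x.
Proof. rewrite !opp_smul, starZ. f_equal; cplx_arith. Qed.

Lemma star_zero : star (zero : A) = zero.
Proof.
  rewrite <- (smul0l zero) at 1. rewrite starZ.
  replace (Cconj C0) with C0 by cplx_arith. apply smul0l.
Qed.

Lemma norm_zero : norm (zero : A) = 0%R.
Proof.
  rewrite <- (smul0l zero), normZ. change C0 with (rc 0).
  rewrite Cabs_rc, Rabs_R0; ring.
Qed.

Lemma norm_rc r x : norm (r *: x) = (Rabs r * norm x)%R.
Proof. rewrite normZ, Cabs_rc; reflexivity. Qed.

Lemma norm_rc_pos r x : 0 <= r -> norm (r *: x) = (r * norm x)%R.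
Proof. intros; rewrite norm_rc, Rabs_pos_eq; auto. Qed.

Lemma norm_opp x : norm (- x) = norm x.
Proof.
  replace (- x) with ((-1) *: x) by nc.
  rewrite norm_rc, Rabs_left by lra; ring.
Qed.

Lemma norm_sub x y : norm (x - y) <= norm x + norm y.
Proof. rewrite <- (norm_opp y). apply norm_triangle. Qed.

Lemma norm_sub_sym x y : norm (x - y) = norm (y - x).
Proof. rewrite <- norm_opp. f_equal; nc. Qed.

Lemma norm_sub_triangle x y z : norm (x - z) <= norm (x - y) + norm (y - z).
Proof. replace (x - z) with ((x - y) + (y - z)) by nc. apply norm_triangle. Qed.

Lemma norm_star x : norm (star x) = norm x.
Proof.
  assert (H : forall y, norm y <= norm (star y)).
  { intros y. pose proof (norm_Cstar A y). pose proof (normM A (star y) y).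
    pose proof (norm_ge0 A y). pose proof (norm_ge0 A (star y)). nra. }
  apply Rle_antisym; [|apply H]. rewrite <- (starK A x) at 2. apply H.
Qed.

Lemma norm_sqr_sa x : star x = x -> norm (x * x) = (norm x * norm x)%R.
Proof. intros H. rewrite <- (norm_Cstar A x), H; reflexivity. Qed.

(** The C*-identity gives $\|1\| = \|1\|^2$. Equality with $1$ fails in the zero algebra, which the
    axioms allow. *)
Lemma norm_one_le1 : norm (one : A) <= 1.
Proof.
  pose proof (norm_sqr_sa one star_one) as H. rewrite mul1l in H.
  pose proof (norm_ge0 A one). nra.
Qed.

Lemma norm_small_eq x y : (forall eps, 0 < eps -> norm (x - y) <= eps) -> x = y.
Proof.
  intros H. apply sub_eq0, norm_eq0.
  destruct (Rle_lt_or_eq_dec 0 _ (norm_ge0 A (x - y))) as [h|h]; [|auto].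
  specialize (H (norm (x - y) / 2)%R). lra.
Qed.

Lemma inv_of_lr x y z : x * y = one -> z * x = one -> invertible A x.
Proof.
  intros H1 H2. exists y. split; [auto|].
  replace y with z; [auto|].
  rewrite <- (mul1r A z), <- H1, mulA, H2, mul1l; reflexivity.
Qed.

Lemma inv_factor x y : x * y = y * x -> invertible A (x * y) -> invertible A x.
Proof.
  intros C (w & H1 & H2). apply inv_of_lr with (y * w) (w * y).
  - rewrite mulA; auto.
  - rewrite <- mulA, <- C; auto.
Qed.

End Elementary.

#[global] Hint Rewrite @star_one @star_zero @star_opp starD starM starZ starK : star.

(** [nc] treats [star x] as an atom, so stars are first pushed down to the variables and removed
    from those known to be self-adjoint. *)
Ltac star_nc :=
  autorewrite with star;
  repeat match goal with H : star ?x = ?x |- _ => rewrite !H end;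
  nc.

(** * Fixed points, Neumann inverses and square roots *)

Section FixedPoint.
Context {A : CStarAlgebra}.
Implicit Types x y z : A.
Local Open Scope cstar_scope.

Definition converges (u : nat -> A) (l : A) : Prop :=
  forall eps, 0 < eps -> exists N, forall n, (N <= n)%nat -> norm (u n - l) < eps.

(** Banach's fixed point theorem on a closed invariant set [I], through which the fixed point
    inherits bounds, self-adjointness and commutation relations. *)
Lemma contraction_fixpoint (I : A -> Prop) (F : A -> A) (k : R) (x0 : A) :
  0 <= k < 1 -> I x0 -> (forall x, I x -> I (F x)) ->
  (forall x y, I x -> I y -> norm (F x - F y) <= k * norm (x - y)) ->
  (forall u l, (forall n, I (u n)) -> converges u l -> I l) ->
  exists l, I l /\ F l = l.
Proof.
  intros Hk I0 IF HF Icl.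
  set (u := fun n => Nat.iter n F x0).
  assert (Iu : forall n, I (u n)) by (induction n; cbn; auto).
  set (d := norm (u 1%nat - u 0%nat)).
  assert (d0 : 0 <= d) by apply norm_ge0.
  assert (kp : forall n, 0 <= k ^ n) by (intros; apply pow_le; lra).
  assert (step : forall n, norm (u (S n) - u n) <= k ^ n * d).
  { induction n as [|n IH]; [cbn [pow]; unfold d; lra|].
    eapply Rle_trans; [apply (HF (u (S n)) (u n)); auto|].
    cbn [pow]. nra. }
  (* The factor $1-k$ turns the geometric sum into a bound provable by induction without
     division. *)
  assert (tail : forall n m, (1 - k) * norm (u (n + m)%nat - u n) <= k ^ n * d * (1 - k ^ m)).
  { induction m as [|m IH].
    - rewrite Nat.add_0_r. replace (u n - u n) with (zero : A) by nc.
      rewrite norm_zero. cbn; lra.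
    - rewrite Nat.add_succ_r.
      pose proof (norm_sub_triangle (u (S (n + m))) (u (n + m)%nat) (u n)).
      pose proof (step (n + m)%nat) as Hs. rewrite pow_add in Hs.
      cbn [pow]. nra. }
  assert (tail' : forall n m, (n <= m)%nat -> (1 - k) * norm (u m - u n) <= k ^ n * d).
  { intros n m Hnm. replace m with (n + (m - n))%nat by lia.
    eapply Rle_trans; [apply tail|]. pose proof (kp n). pose proof (kp (m - n)%nat).
    assert (0 <= k ^ n * d) by nra. nra. }
  assert (small : forall eps, 0 < eps -> exists N, k ^ N * d < eps).
  { intros eps He. destruct (pow_lt_1_zero k) with (y := (eps / (d + 1))%R) as [N HN].
    - rewrite Rabs_pos_eq; lra.
    - apply Rdiv_lt_0_compat; lra.
    - exists N. specialize (HN N (Nat.le_refl N)). rewrite Rabs_pos_eq in HN by auto.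
      apply Rmult_lt_compat_r with (r := (d + 1)%R) in HN; [|lra].
      replace (eps / (d + 1) * (d + 1))%R with eps in HN by (field; lra).
      pose proof (kp N). nra. }
  destruct (complete A u) as [l Hl].
  { intros eps He. destruct (small ((1 - k) * (eps / 2))%R) as [N HN].
    - apply Rmult_lt_0_compat; lra.
    - exists N. intros m n Hm Hn.
      pose proof (tail' N m Hm). pose proof (tail' N n Hn).
      pose proof (norm_sub_triangle (u m) (u N) (u n)).
      rewrite (norm_sub_sym (u N) (u n)) in *. nra. }
  exists l. assert (Il : I l) by (apply (Icl u); auto). split; auto.
  apply norm_small_eq. intros eps He.
  destruct (Hl (eps / 2)%R) as [N HN]; [lra|].
  pose proof (HN N (Nat.le_refl N)). pose proof (HN (S N) (Nat.le_succ_diag_r N)).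
  pose proof (norm_sub_triangle (F l) (u (S N)) l).
  pose proof (HF l (u N) Il (Iu N)) as HFl.
  change (F (u N)) with (u (S N)) in HFl. rewrite (norm_sub_sym l (u N)) in HFl.
  pose proof (norm_ge0 A (u N - l)). nra.
Qed.

(** The fixed points of $y \mapsto 1 + xy$ and $z \mapsto 1 + zx$ are a right and a left inverse. *)
Lemma neumann x : norm x < 1 -> invertible A (one - x).
Proof.
  intros Hx. pose proof (norm_ge0 A x).
  destruct (contraction_fixpoint (fun _ => True) (fun y => one + x * y) (norm x) zero)
    as (y & _ & Hy); auto.
  { intros y z _ _. replace (one + x * y - (one + x * z)) with (x * (y - z)) by nc.
    apply normM. }
  destruct (contraction_fixpoint (fun _ => True) (fun y => one + y * x) (norm x) zero)
    as (z & _ & Hz); auto.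
  { intros y' z _ _. replace (one + y' * x - (one + z * x)) with ((y' - z) * x) by nc.
    rewrite Rmult_comm. apply normM. }
  apply inv_of_lr with y z.
  - transitivity (y - x * y); [nc|]. rewrite <- Hy at 1. nc.
  - transitivity (z - z * x); [nc|]. rewrite <- Hz at 1. nc.
Qed.

Lemma converges_norm_le u l r :
  (forall n, norm (u n) <= r) -> converges u l -> norm l <= r.
Proof.
  intros Hu Hl. apply Rnot_lt_le. intros Hr.
  destruct (Hl (norm l - r)%R) as [N HN]; [lra|].
  specialize (HN N (Nat.le_refl N)). specialize (Hu N).
  rewrite norm_sub_sym in HN.
  pose proof (norm_triangle A (l - u N) (u N)) as H.
  replace (l - u N + u N) with l in H by nc. lra.
Qed.

Lemma converges_star u l :
  (forall n, star (u n) = u n) -> converges u l -> star l = l.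
Proof.
  intros Hu Hl. apply norm_small_eq. intros eps He.
  destruct (Hl (eps / 2)%R) as [N HN]; [lra|].
  specialize (HN N (Nat.le_refl N)).
  pose proof (norm_sub_triangle (star l) (u N) l) as H.
  replace (star l - u N) with (- star (u N - l)) in H
    by (autorewrite with star; rewrite Hu; nc).
  rewrite norm_opp, norm_star in H. lra.
Qed.

Lemma converges_commute u l z :
  (forall n, z * u n = u n * z) -> converges u l -> z * l = l * z.
Proof.
  intros Hu Hl. apply norm_small_eq. intros eps He.
  pose proof (norm_ge0 A z).
  destruct (Hl (eps / (2 * (norm z + 1)))%R) as [N HN]; [apply Rdiv_lt_0_compat; lra|].
  specialize (HN N (Nat.le_refl N)).
  replace (z * l - l * z) with ((u N - l) * z - z * (u N - l))
    by (transitivity (z * l - l * z + (u N * z - z * u N)); [nc|rewrite Hu; nc]).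
  eapply Rle_trans; [apply norm_sub|].
  pose proof (normM A (u N - l) z). pose proof (normM A z (u N - l)).
  apply Rmult_lt_compat_r with (r := (2 * (norm z + 1))%R) in HN; [|lra].
  replace (eps / (2 * (norm z + 1)) * (2 * (norm z + 1)))%R with eps in HN by (field; lra).
  pose proof (norm_ge0 A (u N - l)). nra.
Qed.

(* The strictly positive elements: the self-adjoint ones whose spectrum lies in an
   open disc with centre [t > 0] and radius [t], expressed through the norm. *)
Definition strict_pos (a : A) : Prop :=
  star a = a /\ exists t, norm (t *: one - a) < t.

Lemma strict_pos_inv a : strict_pos a -> invertible A a.
Proof.
  intros [Ha [t Ht]]. pose proof (norm_ge0 A (t *: one - a)).
  destruct (neumann ((/ t) *: (t *: one - a))) as (y & H1 & H2).
  { rewrite norm_rc_pos by (apply Rlt_le, Rinv_0_lt_compat; lra).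
    apply Rmult_lt_reg_l with t; [lra|].
    replace (t * (/ t * norm (t *: one - a)))%R with (norm (t *: one - a)) by (field; lra).
    lra. }
  exists ((/ t) *: y). split.
  - rewrite <- H1. nc.
  - rewrite <- H2. nc.
Qed.

(* [1 - w] is a square root of [1 - c] exactly when [w = (c + w^2) / 2]. *)
Lemma strict_pos_sqrt a : strict_pos a ->
  exists y, strict_pos y /\ y * y = a /\ forall z, z * a = a * z -> z * y = y * z.
Proof.
  intros [Ha [t Ht]]. pose proof (norm_ge0 A (t *: one - a)).
  set (c := (/ t) *: (t *: one - a)). set (r := norm c).
  assert (Hc : star c = c) by (unfold c; star_nc).
  assert (Hr : 0 <= r < 1).
  { unfold r, c. rewrite norm_rc_pos by (apply Rlt_le, Rinv_0_lt_compat; lra).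
    split; [apply Rmult_le_pos; [apply Rlt_le, Rinv_0_lt_compat; lra | lra]|].
    apply Rmult_lt_reg_l with t; [lra|].
    replace (t * (/ t * norm (t *: one - a)))%R with (norm (t *: one - a)) by (field; lra).
    lra. }
  (* The invariant set is the ball of radius [r], on which the map is [r]-Lipschitz, cut down to
     self-adjoint elements commuting with everything that commutes with [c]. *)
  destruct (contraction_fixpoint
    (fun w => norm w <= r /\ star w = w /\ forall z, z * c = c * z -> z * w = w * z)
    (fun w => (1/2) *: (c + w * w)) r zero) as (w & (Hw1 & Hw2 & Hw3) & Hw); auto.
  - rewrite norm_zero, star_zero. repeat split; [lra|]. intros; nc.
  - intros w (H1 & H2 & H3). repeat split.
    + rewrite norm_rc_pos by lra. pose proof (norm_triangle A c (w * w)).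
      pose proof (normM A w w). pose proof (norm_ge0 A w). fold r in H0. nra.
    + star_nc.
    + intros z Hz. specialize (H3 z Hz).
      transitivity ((1/2) *: (z * c + (z * w) * w)); [nc|]. rewrite Hz, H3.
      transitivity ((1/2) *: (c * z + w * (z * w))); [nc|]. rewrite H3. nc.
  - intros x y (Hx & _) (Hy & _).
    replace ((1/2) *: (c + x * x) - (1/2) *: (c + y * y))
      with ((1/2) *: (x * (x - y) + (x - y) * y)) by nc.
    rewrite norm_rc_pos by lra.
    pose proof (norm_triangle A (x * (x - y)) ((x - y) * y)).
    pose proof (normM A x (x - y)). pose proof (normM A (x - y) y).
    pose proof (norm_ge0 A (x - y)). nra.
  - intros u l Hu Hl. repeat split.
    + apply converges_norm_le with u; [intros n; apply (Hu n)|auto].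
    + apply converges_star with u; [intros n; apply (Hu n)|auto].
    + intros z Hz. apply converges_commute with u; [intros n; apply (Hu n); auto|auto].
  - assert (Hs : 0 < sqrt t) by (apply sqrt_lt_R0; lra).
    assert (Hss : (sqrt t * sqrt t)%R = t) by (apply sqrt_sqrt; lra).
    (* Since $a = t(1-c)$ and $(1-w)^2 = 1-c$, the root is rescaled by $\sqrt t$. *)
    exists (sqrt t *: (one - w)). repeat split.
    + star_nc.
    + exists (sqrt t). replace (sqrt t *: one - sqrt t *: (one - w)) with (sqrt t *: w) by nc.
      rewrite norm_rc_pos by lra. nra.
    + transitivity ((sqrt t * sqrt t) *: (one - 2 *: w + w * w)); [nc|].
      rewrite Hss. rewrite <- Hw at 1. unfold c. nc.
    + intros z Hz.
      assert (Hz' : z * c = c * z).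
      { unfold c. transitivity ((/ t) *: (t *: z - z * a)); [nc|]. rewrite Hz; nc. }
      specialize (Hw3 z Hz').
      transitivity (sqrt t *: (z - z * w)); [nc|]. rewrite Hw3; nc.
Qed.

End FixedPoint.

(** * The positive cone *)

(** If [U] failed at some positive point, the supremum of its complement would be positive, and
    [Step] would push [U] below that supremum. This takes the place of spectral arguments, for
    elements and again for matrices. *)
Lemma real_continuation (U : R -> Prop) :
  (exists e, U e) -> (forall e f, e <= f -> U e -> U f) ->
  (forall e, 0 < e -> (forall f, e < f -> U f) -> exists d, 0 < d /\ U (e - d)) ->
  forall e, 0 < e -> U e.
Proof.
  intros [e1 He1] Up Step e He. apply NNPP. intros Ne.
  assert (ub : forall x, U x -> is_upper_bound (fun y => ~ U y) x).
  { intros x Hx y Hy. apply Rnot_lt_le. intros Hxy. apply Hy, (Up x); auto; lra. }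
  destruct (completeness (fun y => ~ U y)) as [s [Hs1 Hs2]].
  { exists e1; auto. }
  { exists e; auto. }
  destruct (Step s) as [d [Hd1 Hd2]].
  - specialize (Hs1 e Ne). lra.
  - intros f Hf. apply NNPP. intros Nf. specialize (Hs1 f Nf). lra.
  - specialize (Hs2 _ (ub _ Hd2)). lra.
Qed.

Section Cone.
Context {A : CStarAlgebra}.
Implicit Types a b c x y z : A.
Local Open Scope cstar_scope.

Lemma strict_pos_add a b : strict_pos a -> strict_pos b -> strict_pos (a + b).
Proof.
  intros [Ha [t Ht]] [Hb [u Hu]]. split; [star_nc|]. exists (t + u)%R.
  replace ((t + u) *: one - (a + b)) with ((t *: one - a) + (u *: one - b)) by nc.
  pose proof (norm_triangle A (t *: one - a) (u *: one - b)). lra.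
Qed.

Lemma strict_pos_scal r a : 0 < r -> strict_pos a -> strict_pos (r *: a).
Proof.
  intros Hr [Ha [t Ht]]. split; [star_nc|]. exists (r * t)%R.
  replace ((r * t) *: one - r *: a) with (r *: (t *: one - a)) by nc.
  rewrite norm_rc_pos by lra. nra.
Qed.

Lemma strict_pos_perturb t x : star x = x -> norm x < t -> strict_pos (t *: one + x).
Proof.
  intros Hx Ht. split; [star_nc|]. exists t.
  replace (t *: one - (t *: one + x)) with (- x) by nc. rewrite norm_opp; auto.
Qed.

Lemma strict_pos_scalar t : 0 < t -> strict_pos (t *: (one : A)).
Proof.
  intros Ht. replace (t *: (one : A)) with (t *: one + (zero : A)) by nc.
  apply strict_pos_perturb; [apply star_zero|]. rewrite norm_zero; auto.
Qed.

Lemma strict_pos_open a : strict_pos a -> exists d, 0 < d /\ strict_pos (a - d *: one).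
Proof.
  intros [Ha [t Ht]]. exists ((t - norm (t *: one - a)) / 2)%R. split; [lra|].
  set (d := ((t - norm (t *: one - a)) / 2)%R). split; [star_nc|]. exists (t - d)%R.
  replace ((t - d) *: one - (a - d *: one)) with (t *: one - a) by nc. unfold d; lra.
Qed.

(** The closure of the strictly positive elements; [positive_pos] and [pos_positive] identify it
    with spectral positivity. *)
Definition pos (a : A) : Prop :=
  star a = a /\ forall eps, 0 < eps -> strict_pos (a + eps *: one).

Lemma strict_pos_pos a : strict_pos a -> pos a.
Proof.
  intros H. split; [apply H|]. intros eps He.
  apply strict_pos_add; auto. apply strict_pos_scalar; auto.
Qed.

(** Strict positivity is open, so a small multiple of [one] can be moved from [b] to [a]. *)
Lemma pos_add_strict a b : pos a -> strict_pos b -> strict_pos (a + b).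
Proof.
  intros [Ha H] Hb. destruct (strict_pos_open b Hb) as [d [Hd Hb']].
  replace (a + b) with ((a + d *: one) + (b - d *: one)) by nc.
  apply strict_pos_add; auto.
Qed.

Lemma pos_of_shift a : star a = a ->
  (forall eps, 0 < eps -> pos (a + eps *: one)) -> pos a.
Proof.
  intros Ha H. split; auto. intros eps He.
  replace (a + eps *: one) with ((a + (eps / 2) *: one) + (eps / 2) *: one) by nc.
  apply pos_add_strict; [apply H; lra|apply strict_pos_scalar; lra].
Qed.

Lemma pos_add a b : pos a -> pos b -> pos (a + b).
Proof.
  intros Ha Hb. split.
  { destruct Ha as [Ha _], Hb as [Hb _]. star_nc. }
  intros eps He. rewrite <- addA. apply pos_add_strict; auto. apply Hb; auto.
Qed.

Lemma pos_zero : pos (zero : A).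
Proof.
  split; [apply star_zero|]. intros eps He. rewrite add0. apply strict_pos_scalar; auto.
Qed.

Lemma pos_scal r a : 0 <= r -> pos a -> pos (r *: a).
Proof.
  intros Hr [Ha H]. destruct (Rle_lt_or_eq_dec 0 r Hr) as [Hr'|<-].
  - split; [star_nc|]. intros eps He.
    replace (r *: a + eps *: one) with (r *: (a + (eps / r) *: one)) by nc.
    apply strict_pos_scal; auto. apply H, Rdiv_lt_0_compat; auto.
  - replace (0 *: a) with (zero : A) by nc. apply pos_zero.
Qed.

Lemma pos_scalar t : 0 <= t -> pos (t *: (one : A)).
Proof.
  intros Ht. apply pos_scal; auto. apply strict_pos_pos.
  replace (one : A) with (1 *: (one : A)) by nc. apply strict_pos_scalar; lra.
Qed.

Lemma pos_closed a : star a = a ->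
  (forall eps, 0 < eps -> exists b, pos b /\ norm (a - b) <= eps) -> pos a.
Proof.
  intros Ha H. split; auto. intros eps He.
  destruct (H (eps / 2)%R) as (b & Hb & Hab); [lra|].
  replace (a + eps *: one) with (b + (eps *: one + (a - b))) by nc.
  apply pos_add_strict; auto. apply strict_pos_perturb; [|lra].
  destruct Hb as [Hb _]. star_nc.
Qed.

Lemma pos_norm_sub x : star x = x -> pos (norm x *: one - x).
Proof.
  intros Hx. split; [star_nc|]. intros eps He.
  replace (norm x *: one - x + eps *: one) with ((norm x + eps) *: one + - x) by nc.
  apply strict_pos_perturb; [star_nc|]. rewrite norm_opp; lra.
Qed.

(* Such a pair is the real and imaginary part of a multiple of a unitary. *)
Lemma sqr_sum_scalar_norm x y t : star x = x -> star y = y -> x * y = y * x ->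
  0 <= t -> x * x + y * y = (t * t) *: one -> norm x <= t /\ norm y <= t.
Proof.
  intros Hx Hy C Ht H. set (u := x + smul Ci y).
  assert (Hu : star u * u = (t * t) *: one).
  { rewrite <- H. unfold u. autorewrite with star. rewrite Hx, Hy.
    transitivity (x * x + y * y + smul Ci (x * y - y * x)); [nc|]. rewrite C; nc. }
  assert (Nu : norm u <= t).
  { pose proof (norm_Cstar A u) as N. rewrite Hu, norm_rc_pos in N by nra.
    pose proof norm_one_le1 (A := A). pose proof (norm_ge0 A u).
    assert (t * t * norm (one : A) <= t * t) by nra. nra. }
  split.
  - replace x with ((1/2) *: (u + star u)) by (unfold u; star_nc).
    rewrite norm_rc_pos by lra. pose proof (norm_triangle A u (star u)) as T.
    rewrite norm_star in T. lra.
  - replace y with (smul (mkC 0 (-1/2)) (u - star u)) by (unfold u; star_nc).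
    rewrite normZ. replace (Cabs (mkC 0 (-1/2))) with (1/2)%R.
    + pose proof (norm_sub u (star u)) as T. rewrite norm_star in T. lra.
    + unfold Cabs; cbn. symmetry. apply sqrt_lem_1; lra.
Qed.

(** For $t > \|x\|$ let $y$ be the root of $t^2 - x^2$. Then $x^2 + y^2 = t^2$ forces $\|y\| \le t$,
    so $x^2$ lies within $t^2$ of the scalar $t^2$. *)
Lemma pos_sqr x : star x = x -> pos (x * x).
Proof.
  intros Hx. split; [star_nc|]. intros eps He.
  pose proof (norm_ge0 A x). set (t := (norm x + eps)%R).
  assert (Ht : 0 < t) by (unfold t; lra).
  destruct (strict_pos_sqrt ((t * t) *: one + - (x * x))) as (y & [Hy _] & Hyy & C).
  { apply strict_pos_perturb; [star_nc|]. rewrite norm_opp, norm_sqr_sa by auto.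
    unfold t; nra. }
  destruct (sqr_sum_scalar_norm x y t) as [_ N]; auto; [| lra | |].
  - apply C. nc.
  - rewrite Hyy. nc.
  - split; [star_nc|]. exists (t * t + eps)%R.
    replace ((t * t + eps) *: one - (x * x + eps *: one))
      with ((t * t) *: one + - (x * x)) by nc.
    rewrite <- Hyy, norm_sqr_sa by auto. pose proof (norm_ge0 A y). nra.
Qed.

(** If $y^2 = b + e$, then $y$ commutes with $z$, and the square of the self-adjoint element $zy$
    differs from $zbz$ by $e z^2$, which is arbitrarily small. *)
Lemma pos_sandwich b z : pos b -> star z = z -> z * b = b * z -> pos (z * b * z).
Proof.
  intros [Hb H] Hz C. apply pos_closed.
  { autorewrite with star. rewrite Hz, Hb. apply mulA. }
  intros eps He. pose proof (norm_ge0 A z).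
  set (e := (eps / (norm z * norm z + 1))%R).
  assert (He' : 0 < e) by (apply Rdiv_lt_0_compat; nra).
  destruct (strict_pos_sqrt (b + e *: one)) as (y & [Hy _] & Hyy & Cy); auto.
  assert (Czy : z * y = y * z).
  { apply Cy. transitivity (z * b + e *: z); [nc|]. rewrite C; nc. }
  exists ((z * y) * (z * y)). split.
  - apply pos_sqr. autorewrite with star. rewrite Hy, Hz; auto.
  - replace (z * b * z - z * y * (z * y)) with (- (e *: (z * z))).
    + rewrite norm_opp, norm_rc_pos, norm_sqr_sa by (auto; lra).
      apply Rmult_le_reg_r with (norm z * norm z + 1)%R; [nra|].
      unfold e. field_simplify; [|nra]. nra.
    + rewrite Czy at 2.
      transitivity (z * b * z - z * (y * y) * z); [rewrite Hyy; nc|nc].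
Qed.

(** With $d = b^{-1}$, the sandwich $(1-kd)b(1-kd) = b - 2k + k^2 d$ is positive. For $k\|d\| < 1$
    the remainder $2k - k^2 d$ is strictly positive. *)
Lemma pos_inv_strict b : pos b -> invertible A b -> strict_pos b.
Proof.
  intros Pb (d & H1 & H2). pose proof (proj1 Pb) as Hb.
  assert (Hd : star d = d).
  { rewrite <- (mul1r A (star d)), <- H1, mulA. rewrite <- Hb at 1.
    rewrite <- starM, H1, star_one, mul1l; reflexivity. }
  pose proof (norm_ge0 A d). set (k := (/ (norm d + 1))%R).
  assert (Hk : 0 < k) by (apply Rinv_0_lt_compat; lra).
  assert (Hkd : k * norm d < 1).
  { apply Rmult_lt_reg_r with (norm d + 1)%R; [lra|]. unfold k. field_simplify; lra. }
  assert (P : pos ((one - k *: d) * b * (one - k *: d))).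
  { apply pos_sandwich; auto; [star_nc|].
    transitivity (b - k *: (d * b)); [nc|]. rewrite H2.
    transitivity (b - k *: (b * d)); [rewrite H1; nc | nc]. }
  replace b with ((one - k *: d) * b * (one - k *: d) +
                  (k *: one + (k *: one + - ((k * k) *: d)))).
  - apply pos_add_strict; auto. apply strict_pos_add; [apply strict_pos_scalar; auto|].
    apply strict_pos_perturb; [star_nc|]. rewrite norm_opp, norm_rc_pos by nra. nra.
  - transitivity (b - k *: (d * b) - k *: (b * d) + (k * k) *: (d * b * d)
                  + (2 * k) *: one - (k * k) *: d); [nc|].
    rewrite H1, H2; nc.
Qed.

(** Continuation of the positivity of $a + e$ downwards from $e = \|a\|$: at each $e > 0$
    invertibility makes positivity strict, and strict positivity is open. *)
Lemma pos_of_invertible a : star a = a ->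
  (forall eps, 0 < eps -> invertible A (a + eps *: one)) -> pos a.
Proof.
  intros Ha Hinv. apply pos_of_shift; auto.
  apply real_continuation.
  - exists (norm a). replace (a + norm a *: one) with (norm (- a) *: one - (- a))
      by (rewrite norm_opp; nc).
    apply pos_norm_sub; star_nc.
  - intros e f Hef H. replace (a + f *: one) with ((a + e *: one) + (f - e) *: one) by nc.
    apply pos_add; auto. apply pos_scalar; lra.
  - intros e He H.
    assert (P : pos (a + e *: one)).
    { apply pos_of_shift; [star_nc|]. intros eps Heps.
      replace (a + e *: one + eps *: one) with (a + (e + eps) *: one) by nc.
      apply H; lra. }
    apply pos_inv_strict in P; [|apply Hinv; auto].
    destruct (strict_pos_open _ P) as [d [Hd Hs]]. exists d. split; auto.
    apply strict_pos_pos. replace (a + (e - d) *: one) with (a + e *: one - d *: one) by nc.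
    auto.
Qed.

Lemma positive_pos a : positive A a -> pos a.
Proof.
  intros [Ha H]. apply pos_of_invertible; auto. intros eps He.
  apply NNPP. intros N. destruct (H (rc (- eps))) as [_ H'].
  - replace (smul (Copp (rc (- eps))) one) with (eps *: (one : A)) by nc. auto.
  - cbn in H'; lra.
Qed.

Lemma pos_positive a : pos a -> positive A a.
Proof.
  intros [Ha H]. split; auto. intros l N.
  assert (Im : Cim l = 0%R).
  { apply NNPP. intros Hl. apply N.
    (* With $l = u + iv$ and $b = a - u$, the product $(b - iv)(b + iv) = b^2 + v^2$ is strictly
       positive, hence invertible. *)
    set (b := a - Cre l *: one). assert (Hb : star b = b) by (unfold b; star_nc).
    replace (a + smul (Copp l) one) with (b - smul (mkC 0 (Cim l)) one) by (unfold b; nc).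
    apply inv_factor with (b + smul (mkC 0 (Cim l)) one); [nc|].
    apply strict_pos_inv.
    replace ((b - smul (mkC 0 (Cim l)) one) * (b + smul (mkC 0 (Cim l)) one))
      with (b * b + (Cim l * Cim l) *: one) by nc.
    apply (pos_sqr b Hb). nra. }
  split; auto. apply Rnot_lt_le. intros Hl. apply N, strict_pos_inv.
  replace (smul (Copp l) one) with ((- Cre l) *: (one : A)) by nc.
  apply H; lra.
Qed.

(** Let $p, q$ be the roots of $t + \varepsilon - x$ and $t + \varepsilon + x$. Then $x$ and $pq$
    are commuting self-adjoint elements with $x^2 + (pq)^2 = (t+\varepsilon)^2$. *)
Lemma norm_le_of_pos x t : star x = x -> 0 <= t ->
  pos (t *: one - x) -> pos (t *: one + x) -> norm x <= t.
Proof.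
  intros Hx Ht [_ P] [_ Q]. apply Rle_plus_epsilon. intros eps He.
  destruct (strict_pos_sqrt _ (P eps He)) as (p & [Hp _] & Hpp & Cp).
  destruct (strict_pos_sqrt _ (Q eps He)) as (q & [Hq _] & Hqq & Cq).
  assert (Cxp : x * p = p * x) by (apply Cp; nc).
  assert (Cxq : x * q = q * x) by (apply Cq; nc).
  assert (Cpq : p * q = q * p).
  { apply Cq. transitivity ((t + eps) *: p + p * x); [nc|]. rewrite <- Cxp; nc. }
  apply (sqr_sum_scalar_norm x (p * q)); auto.
  - autorewrite with star. rewrite Hp, Hq; auto.
  - rewrite mulA, Cxp, <- mulA, Cxq, mulA; reflexivity.
  - lra.
  - rewrite Cpq at 1. transitivity (x * x + q * (p * p) * q); [nc|].
    rewrite Hpp.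
    transitivity (x * x + (t + eps) *: (q * q) - q * (x * q)); [nc|].
    rewrite Cxq. transitivity (x * x + (t + eps) *: (q * q) - (q * q) * x); [nc|].
    rewrite Hqq. nc.
Qed.

(** The factorisation $(t + \varepsilon)^2 - m^2 = (t + \varepsilon - m)(t + \varepsilon + m)$ has a
    strictly positive left side, so $t - m + \varepsilon$ is invertible. *)
Lemma pos_of_sqr_le m t : star m = m -> 0 <= t ->
  pos ((t * t) *: one - m * m) -> pos (t *: one - m).
Proof.
  intros Hm Ht P. apply pos_of_invertible; [star_nc|]. intros eps He.
  apply inv_factor with ((t + eps) *: one + m); [nc|].
  apply strict_pos_inv.
  replace ((t *: one - m + eps *: one) * ((t + eps) *: one + m))
    with ((t * t *: one - m * m) + (2 * t * eps + eps * eps) *: one) by nc.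
  apply P. nra.
Qed.

(** The formula $(yx+t)^{-1} = t^{-1}(1 - y(xy+t)^{-1}x)$, which shows that $xy$ and $yx$ have the
    same nonzero spectrum. *)
Lemma invertible_swap x y t : 0 < t ->
  invertible A (x * y + t *: one) -> invertible A (y * x + t *: one).
Proof.
  intros Ht (w & H1 & H2). exists ((/ t) *: (one - y * w * x)). split.
  - transitivity ((/ t) *: (y * x + t *: one - y * ((x * y + t *: one) * w) * x)); [nc|].
    rewrite H1; nc.
  - transitivity ((/ t) *: (y * x + t *: one - y * (w * (x * y + t *: one)) * x)); [nc|].
    rewrite H2; nc.
Qed.

Lemma pos_star_mul_swap c t : 0 <= t ->
  pos (c * star c + t *: one) -> pos (star c * c + t *: one).
Proof.
  intros Ht [_ P]. apply pos_of_invertible; [star_nc|]. intros eps He.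
  replace (star c * c + t *: one + eps *: one) with (star c * c + (t + eps) *: one) by nc.
  apply invertible_swap; [lra|].
  replace (c * star c + (t + eps) *: one) with (c * star c + t *: one + eps *: one) by nc.
  apply strict_pos_inv, P; auto.
Qed.

(* With [a = b* b], [h = sqrt (a^2 + e^2)] and [c = b sqrt (h - a)] one has
   [c* c = (e^2 - (h - a)^2) / 2], which bounds [c* c] from above, hence [c c*] and
   then [c* c] from below, so that [h - a = O(e)]. *)
Lemma pos_star_mul b : pos (star b * b).
Proof.
  set (a := star b * b). assert (Ha : star a = a) by (unfold a; star_nc).
  apply pos_of_shift; auto. intros eps Heps.
  set (e := (eps / 2)%R). assert (He : 0 < e) by (unfold e; lra).
  destruct (strict_pos_sqrt (a * a + (e * e) *: one)) as (h & Sh & Hhh & Ch).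
  { apply pos_sqr; auto. nra. }
  pose proof (proj1 Sh) as Hh.
  assert (Cah : a * h = h * a) by (apply Ch; nc).
  set (m := h - a). assert (Hm : star m = m) by (unfold m; star_nc).
  assert (Hfac : m * (h + a) = (e * e) *: one).
  { unfold m. transitivity (h * h - a * a + (h * a - a * h)); [nc|].
    rewrite Cah, Hhh; nc. }
  assert (Cm : m * (h + a) = (h + a) * m).
  { unfold m. transitivity ((h + a) * (h - a) + 2 *: (h * a - a * h)); [nc|].
    rewrite Cah; nc. }
  assert (Pm : pos m).
  (* The factors $m + d$ and $h + a + d$ commute, and their product $2dh + e^2 + d^2$ is strictly
     positive. *)
  { apply pos_of_invertible; auto. intros d Hd.
    apply inv_factor with (h + a + d *: one).
    - transitivity (m * (h + a) + d *: (m + h + a) + (d * d) *: one); [nc|].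
      rewrite Cm; nc.
    - apply strict_pos_inv.
      replace ((m + d *: one) * (h + a + d *: one))
        with ((2 * d) *: h + (e * e + d * d) *: one).
      + apply strict_pos_add; [apply strict_pos_scal; [lra|auto]|].
        apply strict_pos_scalar; nra.
      + transitivity (m * (h + a) + d *: (m + h + a) + (d * d) *: one);
          [rewrite Hfac; unfold m; nc | nc]. }
  assert (Sm : strict_pos m).
  { apply pos_inv_strict; auto. apply inv_factor with (h + a); auto.
    rewrite Hfac. apply strict_pos_inv, strict_pos_scalar; nra. }
  destruct (strict_pos_sqrt m Sm) as (w & [Hw _] & Hww & Cw).
  assert (Caw : a * w = w * a).
  { apply Cw. unfold m. transitivity (a * h - a * a); [nc|]. rewrite Cah; nc. }
  set (c := b * w).
  assert (Hcc : star c * c = (1/2) *: ((e * e) *: one - m * m)).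
  { unfold c. autorewrite with star. rewrite Hw.
    transitivity (w * (a * w)); [unfold a; nc|]. rewrite Caw, mulA, Hww.
    rewrite <- Hfac. unfold m. nc. }
  assert (Pcc : pos (star c * c + (e * e / 2) *: one)).
  { apply pos_star_mul_swap; [nra|].
    replace (c * star c + (e * e / 2) *: one)
      with ((c * star c + star c * c) + (1/2) *: (m * m)) by (rewrite Hcc; nc).
    apply pos_add; [|apply pos_scal; [lra|apply pos_sqr; auto]].
    (* The sum is twice the sum of the squares of the real and imaginary parts of [c]. *)
    replace (c * star c + star c * c) with
      ((1/2) *: ((c + star c) * (c + star c)) +
       (1/2) *: (smul Ci (c - star c) * smul Ci (c - star c))) by nc.
    apply pos_add; apply pos_scal; try lra; apply pos_sqr; star_nc. }
  assert (P2 : pos (eps *: one - m)).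
  { apply pos_of_sqr_le; auto; [lra|].
    (* Since [eps] is $2e$, the scalar left over is $2e^2 \ge 0$. *)
    replace ((eps * eps) *: one - m * m)
      with (2 *: (star c * c + (e * e / 2) *: one) + (eps * eps - 2 * e * e) *: one)
      by (rewrite Hcc; nc).
    apply pos_add; [apply pos_scal; [lra|auto]|]. apply pos_scalar. unfold e; nra. }
  replace (a + eps *: one) with (h + (eps *: one - m)) by (unfold m; nc).
  apply pos_add; auto. apply strict_pos_pos; auto.
Qed.

End Cone.

(** * Linear functionals and states *)

Section Functionals.
Context {A : CStarAlgebra}.
Implicit Types x y z : A.
Local Open Scope cstar_scope.

Lemma linear_zero f : linear A f -> f zero = C0.
Proof. intros [_ H]. rewrite <- (smul0l zero), H. cplx_arith. Qed.

Lemma linear_opp f x : linear A f -> f (- x) = Copp (f x).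
Proof. intros [_ H]. rewrite opp_smul, H. cplx_arith. Qed.

Lemma linear_asum f n (u : nat -> A) : linear A f ->
  f (asum A n u) = csum n (fun i => f (u i)).
Proof.
  intros H. induction n as [|n IH]; cbn.
  - apply linear_zero; auto.
  - rewrite (proj1 H), IH; reflexivity.
Qed.

(** * Real and imaginary parts, and hermitian functionals *)

Definition re_part x : A := (1/2) *: (x + star x).
Definition im_part x : A := smul (mkC 0 (-1/2)) (x - star x).

Lemma re_part_sa x : star (re_part x) = re_part x.
Proof. unfold re_part. star_nc. Qed.

Lemma im_part_sa x : star (im_part x) = im_part x.
Proof. unfold im_part. star_nc. Qed.

Lemma re_im_part x : x = re_part x + smul Ci (im_part x).
Proof. unfold re_part, im_part. nc. Qed.

Lemma re_part_of_sa x : star x = x -> re_part x = x.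
Proof. intros H. unfold re_part. rewrite H. nc. Qed.

Lemma im_part_of_sa x : star x = x -> im_part x = zero.
Proof. intros H. unfold im_part. rewrite H. nc. Qed.

Lemma norm_re_part x : norm (re_part x) <= norm x.
Proof.
  unfold re_part. rewrite norm_rc_pos by lra.
  pose proof (norm_triangle A x (star x)) as H. rewrite norm_star in H. lra.
Qed.

(** The complex-linear hermitian functional with the values of [F] on self-adjoint elements; its
    other values come from these. *)
Definition complexify (F : A -> R) (x : A) : Cplx := mkC (F (re_part x)) (F (im_part x)).

Definition real_linear (F : A -> R) : Prop :=
  (forall x y, F (x + y) = (F x + F y)%R) /\ (forall r x, F (r *: x) = (r * F x)%R).

Lemma complexify_linear F : real_linear F -> linear A (complexify F).
Proof.
  intros [Fadd Fscal]. unfold complexify. split.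
  - intros x y.
    replace (re_part (x + y)) with (re_part x + re_part y) by (unfold re_part; star_nc).
    replace (im_part (x + y)) with (im_part x + im_part y) by (unfold im_part; star_nc).
    rewrite !Fadd. reflexivity.
  - intros [a b] x.
    replace (re_part (smul (mkC a b) x)) with (a *: re_part x + (- b) *: im_part x)
      by (unfold re_part, im_part; star_nc).
    replace (im_part (smul (mkC a b) x)) with (a *: im_part x + b *: re_part x)
      by (unfold re_part, im_part; star_nc).
    rewrite !Fadd, !Fscal. cplx_arith.
Qed.

Lemma complexify_star F x : real_linear F ->
  complexify F (star x) = Cconj (complexify F x).
Proof.
  intros [_ Fscal]. unfold complexify, Cconj; cbn.
  replace (re_part (star x)) with (re_part x) by (unfold re_part; star_nc).
  replace (im_part (star x)) with ((-1) *: im_part x) by (unfold im_part; star_nc).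
  rewrite Fscal. f_equal; ring.
Qed.

Lemma complexify_sa F x : real_linear F -> star x = x -> complexify F x = rc (F x).
Proof.
  intros [_ Fscal] H. unfold complexify, rc.
  rewrite re_part_of_sa, im_part_of_sa by auto. f_equal.
  replace (zero : A) with (0 *: (zero : A)) by nc. rewrite Fscal; ring.
Qed.

(* A rotation makes [f x] real, and then only the real part of [x] matters. *)
Lemma hermitian_bound f x : linear A f -> (forall y, f (star y) = Cconj (f y)) ->
  (forall y, star y = y -> Cre (f y) <= norm y) -> Cabs (f x) <= norm x.
Proof.
  intros [fadd fscal] Hstar Hb. pose proof (Cabs_ge0 (f x)) as Hr.
  set (r := Cabs (f x)) in *. assert (Hrr := Cabs_sqr (f x)). fold r in Hrr.
  destruct (Rle_lt_or_eq_dec 0 r Hr) as [Hr'|<-]; [|apply norm_ge0].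
  (* The unimodular scalar $\overline{f(x)}/|f(x)|$, for which $f(cx) = r$. *)
  set (c := mkC (Cre (f x) / r) (- Cim (f x) / r)).
  assert (Hc : Cabs c = 1%R).
  { unfold Cabs, c; cbn.
    replace (Cre (f x) / r * (Cre (f x) / r) + - Cim (f x) / r * (- Cim (f x) / r))%R
      with ((Cre (f x) * Cre (f x) + Cim (f x) * Cim (f x)) / (r * r))%R by (field; lra).
    rewrite <- Hrr. replace (r * r / (r * r))%R with 1%R by (field; lra). apply sqrt_1. }
  replace r with (Cre (f (re_part (smul c x)))).
  - eapply Rle_trans; [apply Hb, re_part_sa|].
    eapply Rle_trans; [apply norm_re_part|]. rewrite normZ, Hc. lra.
  - unfold re_part. rewrite fscal, fadd, Hstar, fscal. cbn.
    replace (Cre (f x) / r * Cre (f x) - - Cim (f x) / r * Cim (f x))%R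
      with ((Cre (f x) * Cre (f x) + Cim (f x) * Cim (f x)) / r)%R by (field; lra).
    rewrite <- Hrr. field; lra.
Qed.

(** * States are hermitian and contractive *)

Section State.
Variable phi : A -> Cplx.
Hypothesis Hphi : state A phi.

Lemma state_scalar r : phi (r *: one) = rc r.
Proof. destruct Hphi as ((_ & H) & H1 & _). rewrite H, H1. cplx_arith. Qed.

Lemma state_pos a : pos a -> Cim (phi a) = 0%R /\ 0 <= Cre (phi a).
Proof. intros H. apply Hphi, pos_positive, H. Qed.

Lemma state_sa x : star x = x -> Cim (phi x) = 0%R /\ Cre (phi x) <= norm x.
Proof.
  intros Hx. destruct (state_pos _ (pos_norm_sub x Hx)) as [H1 H2].
  rewrite (proj1 (proj1 Hphi)), state_scalar, linear_opp in H1, H2 by apply Hphi.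
  cbn in H1, H2. split; lra.
Qed.

Lemma state_star x : phi (star x) = Cconj (phi x).
Proof.
  destruct (state_sa _ (re_part_sa x)) as [H1 _].
  destruct (state_sa _ (im_part_sa x)) as [H2 _].
  pose proof (proj1 Hphi) as [Hadd Hscal].
  replace (star x) with (re_part x + smul (Copp Ci) (im_part x))
    by (unfold re_part, im_part; nc).
  replace (phi x) with (phi (re_part x + smul Ci (im_part x)))
    by (rewrite <- re_im_part; auto).
  rewrite !Hadd, !Hscal.
  apply Cplx_ext; cbn [Cre Cim Cadd Cmul Copp Cconj Ci]; rewrite ?H1, ?H2; ring.
Qed.

Lemma state_bound x : Cabs (phi x) <= norm x.
Proof.
  apply hermitian_bound; [apply Hphi | apply state_star | apply state_sa].
Qed.

End State.
End Functionals.

(** * States are completely positive *)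

Lemma Rabs_le_elim a b : Rabs a <= b -> - b <= a <= b.
Proof. unfold Rabs; destruct (Rcase_abs a); lra. Qed.

Section Vectors.
Context {A : CStarAlgebra}.
Local Open Scope cstar_scope.
Implicit Types u v w : nat -> A.

Lemma asum_ext n v w : (forall i, (i < n)%nat -> v i = w i) -> asum A n v = asum A n w.
Proof.
  induction n as [|n IH]; cbn; intros H; auto.
  rewrite H by lia. rewrite IH by (intros; apply H; lia). reflexivity.
Qed.

Lemma asum_add n v w : asum A n (fun i => v i + w i) = asum A n v + asum A n w.
Proof. induction n as [|n IH]; cbn; [nc|]. rewrite IH; nc. Qed.

Lemma asum_smul n c v : asum A n (fun i => smul c (v i)) = smul c (asum A n v).
Proof. induction n as [|n IH]; cbn; [nc|]. rewrite IH; nc. Qed.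

Lemma asum_mull n x v : asum A n (fun i => x * v i) = x * asum A n v.
Proof. induction n as [|n IH]; cbn; [nc|]. rewrite IH; nc. Qed.

Lemma asum_mulr n x v : asum A n (fun i => v i * x) = asum A n v * x.
Proof. induction n as [|n IH]; cbn; [nc|]. rewrite IH; nc. Qed.

Lemma asum_zero n : asum A n (fun _ => zero) = zero.
Proof. induction n as [|n IH]; cbn; auto. rewrite IH; nc. Qed.

Lemma asum_star n v : star (asum A n v) = asum A n (fun i => star (v i)).
Proof. induction n as [|n IH]; cbn; [apply star_zero|]. rewrite starD, IH; auto. Qed.

Lemma asum_swap n m (f : nat -> nat -> A) :
  asum A n (fun i => asum A m (fun j => f i j)) =
  asum A m (fun j => asum A n (fun i => f i j)).
Proof.
  induction n as [|n IH]; cbn; [rewrite asum_zero; auto|].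
  rewrite IH, asum_add; auto.
Qed.

Lemma asum_delta n v i : (i < n)%nat -> asum A n (fun j => mid A i j * v j) = v i.
Proof.
  induction n as [|n IH]; intros Hi; [lia|]. cbn. unfold mid at 2.
  destruct (Nat.eqb_spec i n) as [->|Hne].
  - rewrite (asum_ext n _ (fun _ => zero)).
    + rewrite asum_zero; nc.
    + intros j Hj. unfold mid. destruct (Nat.eqb_spec n j); [lia|nc].
  - rewrite IH by lia. nc.
Qed.

(** The [A]-valued inner product of the Hilbert module $A^n$, conjugate-linear in the first
    argument. *)
Definition inner n v w : A := asum A n (fun i => star (v i) * w i).
Definition mvec n (X : mat A) v : nat -> A := fun i => asum A n (fun j => X i j * v j).

Lemma inner_ext n v v' w w' : (forall i, (i < n)%nat -> v i = v' i) ->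
  (forall i, (i < n)%nat -> w i = w' i) -> inner n v w = inner n v' w'.
Proof. intros H H'. apply asum_ext. intros i Hi. rewrite H, H' by auto; auto. Qed.

Lemma inner_star n v w : star (inner n v w) = inner n w v.
Proof.
  unfold inner. rewrite asum_star. apply asum_ext; intros. autorewrite with star; auto.
Qed.

Lemma inner_addr n u v w k :
  inner n u (fun i => v i + k *: w i) = inner n u v + k *: inner n u w.
Proof.
  unfold inner. rewrite <- asum_smul, <- asum_add. apply asum_ext; intros; nc.
Qed.

Lemma inner_addl n u v w k :
  inner n (fun i => v i + k *: w i) u = inner n v u + k *: inner n w u.
Proof.
  unfold inner. rewrite <- asum_smul, <- asum_add. apply asum_ext; intros.
  autorewrite with star; nc.
Qed.

Lemma mvec_add n X v w k i :
  mvec n X (fun i => v i + k *: w i) i = mvec n X v i + k *: mvec n X w i.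
Proof.
  unfold mvec. rewrite <- asum_smul, <- asum_add. apply asum_ext; intros; nc.
Qed.

Lemma inner_mvec_sa n X v w : meq A n (mstar A X) X ->
  inner n (mvec n X v) w = inner n v (mvec n X w).
Proof.
  intros HX. unfold inner, mvec.
  transitivity (asum A n (fun i => asum A n (fun j => star (v j) * (X j i * w i)))).
  - apply asum_ext. intros i Hi. rewrite asum_star, <- asum_mulr. apply asum_ext.
    intros j Hj. rewrite <- (HX j i) by auto. unfold mstar. autorewrite with star. nc.
  - rewrite asum_swap. apply asum_ext. intros i Hi. apply asum_mull.
Qed.

Lemma mvec_inverse n X Y v i : meq A n (mmul A n X Y) (mid A) -> (i < n)%nat ->
  mvec n X (mvec n Y v) i = v i.
Proof.
  intros H Hi. rewrite <- (asum_delta n v i Hi). unfold mvec.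
  transitivity (asum A n (fun k => asum A n (fun j => X i k * (Y k j * v j)))).
  - apply asum_ext; intros; symmetry; apply asum_mull.
  - rewrite asum_swap. apply asum_ext. intros j Hj. rewrite <- (H i j) by auto.
    unfold mmul. rewrite <- asum_mulr. apply asum_ext; intros; nc.
Qed.

Lemma mvec_shift n X e v i : (i < n)%nat ->
  mvec n (fun i j => X i j + smul e (mid A i j)) v i = mvec n X v i + smul e (v i).
Proof.
  intros Hi. rewrite <- (asum_delta n v i Hi). unfold mvec.
  rewrite <- asum_smul, <- asum_add. apply asum_ext; intros; nc.
Qed.

(* Sandwiching [B] with [1 - k B^-1] gives [B - 2 k + k^2 B^-1], whence [B] is bounded
   below by a positive constant once [k] is small. *)
Lemma inner_sandwich n B v w k : meq A n (mstar A B) B ->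
  (forall i, (i < n)%nat -> mvec n B w i = v i) ->
  let u := fun i => v i + (- k) *: w i in
  inner n u (mvec n B u) =
  inner n v (mvec n B v) + (- 2 * k) *: inner n v v + (k * k) *: inner n w v.
Proof.
  intros HB Hw u.
  rewrite (inner_ext n u u (mvec n B u) (fun i => mvec n B v i + (- k) *: v i)).
  2: auto.
  2: { intros i Hi. unfold u. rewrite mvec_add, Hw by auto. auto. }
  rewrite inner_addr. unfold u. rewrite !inner_addl.
  rewrite <- (inner_mvec_sa n B w v HB).
  rewrite (inner_ext n (mvec n B w) v v v) by auto.
  nc.
Qed.

(** * The real-valued form of a matrix induced by a state *)

Variable phi : A -> Cplx.
Hypothesis Hphi : state A phi.

Let rho (x : A) : R := Cre (phi x).

Lemma rho_add (x y : A) : rho (x + y) = (rho x + rho y)%R.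
Proof. unfold rho. rewrite (proj1 (proj1 Hphi)); auto. Qed.

Lemma rho_scal r (x : A) : rho (r *: x) = (r * rho x)%R.
Proof. unfold rho. rewrite (proj2 (proj1 Hphi)); cbn; ring. Qed.

Lemma rho_star (x : A) : rho (star x) = rho x.
Proof. unfold rho. rewrite state_star; auto. Qed.

Lemma rho_pos (x : A) : pos x -> 0 <= rho x.
Proof. apply state_pos; auto. Qed.

Lemma rho_inner_ge0 n v : 0 <= rho (inner n v v).
Proof.
  unfold inner. induction n as [|n IH]; cbn.
  - unfold rho. rewrite linear_zero by apply Hphi. cbn; lra.
  - rewrite rho_add. pose proof (rho_pos _ (pos_star_mul (v n))). lra.
Qed.

Lemma rho_term_le n v i : (i < n)%nat -> rho (star (v i) * v i) <= rho (inner n v v).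
Proof.
  induction n as [|n IH]; intros Hi; [lia|].
  unfold inner; cbn; fold (inner n v v). rewrite rho_add.
  pose proof (rho_pos _ (pos_star_mul (v n))). pose proof (rho_inner_ge0 n v).
  destruct (Nat.eq_dec i n) as [->|]; [lra|]. specialize (IH ltac:(lia)). lra.
Qed.

(** An additive Cauchy-Schwarz inequality, free of square roots: expand $\rho$ on the squares of $x
    \pm dy$ and use $(dy)^*(dy) \le \|d\|^2 y^*y$. *)
Lemma rho_cauchy (x d y : A) :
  Rabs (rho (star x * (d * y))) <=
  rho (star x * x) + norm d * norm d * rho (star y * y).
Proof.
  assert (D : rho (star (d * y) * (d * y)) <= norm d * norm d * rho (star y * y)).
  { pose proof (pos_norm_sub (star d * d)) as P.
    rewrite norm_Cstar in P.
    assert (S0 : star (star d * d) = star d * d) by star_nc. specialize (P S0).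
    destruct P as [_ P]. apply Rle_plus_epsilon. intros eps He.
    pose proof (rho_pos _ (pos_star_mul y)) as Py.
    set (e := (eps / (rho (star y * y)%cs + 1))%R).
    assert (He' : 0 < e) by (apply Rdiv_lt_0_compat; lra).
    (* Writing $\|d\|^2 + e - d^*d = q^2$ turns the difference of the two sides, up to [e], into the
       positive element $(qy)^*(qy)$. *)
    destruct (strict_pos_sqrt _ (P e He')) as (q & [Hq _] & Hqq & _).
    pose proof (rho_pos _ (pos_star_mul (q * y))) as Pq.
    replace (star (q * y) * (q * y)) with
      ((norm d * norm d + e) *: (star y * y) + (-1) *: (star (d * y) * (d * y))) in Pq.
    - rewrite rho_add, !rho_scal in Pq.
      assert (e * rho (star y * y) <= eps).
      { apply Rmult_le_reg_r with (rho (star y * y)%cs + 1)%R; [lra|].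
        unfold e. field_simplify; [|lra]. nra. }
      nra.
    - autorewrite with star. rewrite Hq.
      transitivity (star y * (q * q) * y); [rewrite Hqq; nc|nc]. }
  pose proof (rho_pos _ (pos_star_mul (x + d * y))) as P1.
  pose proof (rho_pos _ (pos_star_mul (x - d * y))) as P2.
  assert (E1 : star (x + d * y) * (x + d * y) =
    star x * x + star (d * y) * (d * y) + (star x * (d * y) + star (star x * (d * y)))).
  { star_nc. }
  assert (E2 : star (x - d * y) * (x - d * y) =
    star x * x + star (d * y) * (d * y) + (-1) *: (star x * (d * y) + star (star x * (d * y)))).
  { star_nc. }
  rewrite E1, !rho_add, rho_star in P1.
  rewrite E2, !rho_add, rho_scal, !rho_add, rho_star in P2.
  apply Rabs_le. pose proof (rho_pos _ (pos_star_mul x)).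
  pose proof (rho_pos _ (pos_star_mul (d * y))). lra.
Qed.

Lemma rho_asum_bounded (N : (nat -> A) -> R) (g : (nat -> A) -> nat -> A) n :
  (forall v, 0 <= N v) ->
  (forall i, (i < n)%nat -> exists M, forall v, Rabs (rho (g v i)) <= M * N v) ->
  exists M, forall v, Rabs (rho (asum A n (g v))) <= M * N v.
Proof.
  intros HN. induction n as [|n IH]; intros H.
  - exists 0%R. intros v. cbn. unfold rho. rewrite linear_zero by apply Hphi. cbn.
    rewrite Rabs_R0; lra.
  - destruct IH as [M1 H1]; [intros; apply H; lia|].
    destruct (H n) as [M2 H2]; [lia|]. exists (M1 + M2)%R. intros v. cbn.
    rewrite rho_add. eapply Rle_trans; [apply Rabs_triang|].
    specialize (H1 v). specialize (H2 v). lra.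
Qed.

(** This stands in for a C*-norm on matrices: each entry contributes a bound by [rho_cauchy], and
    these are summed over rows and columns. *)
Lemma rho_matrix_bounded n X :
  exists M, 0 <= M /\
    forall v, Rabs (rho (inner n v (mvec n X v))) <= M * rho (inner n v v).
Proof.
  destruct (rho_asum_bounded (fun v => rho (inner n v v))
              (fun v i => star (v i) * mvec n X v i) n) as [M HM].
  - intros v; apply rho_inner_ge0.
  - intros i Hi.
    destruct (rho_asum_bounded (fun v => rho (inner n v v))
                (fun v j => star (v i) * (X i j * v j)) n) as [M HM].
    + intros v; apply rho_inner_ge0.
    + intros j Hj. exists (1 + norm (X i j) * norm (X i j))%R. intros v.
      eapply Rle_trans; [apply rho_cauchy|].
      pose proof (rho_term_le n v i Hi). pose proof (rho_term_le n v j Hj).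
      pose proof (norm_ge0 A (X i j)). nra.
    + exists M. intros v. unfold mvec. rewrite <- asum_mull. apply HM.
  - exists (Rabs M). split; [apply Rabs_pos|]. intros v.
    eapply Rle_trans; [apply HM|]. pose proof (rho_inner_ge0 n v).
    pose proof (Rle_abs M). nra.
Qed.

(** Continuation in $e$ for the form of $X + e$: it is nonnegative for large $e$ by boundedness, and
    wherever it is nonnegative with $e > 0$, sandwiching by the inverse of $X + e$ allows a smaller
    $e$. Then $e$ tends to $0$. *)
Lemma rho_mpositive n X v : mpositive A n X -> 0 <= rho (inner n v (mvec n X v)).
Proof.
  intros [HX Hspec].
  assert (Hlim : forall v e, (forall f, e < f ->
    0 <= rho (inner n v (mvec n X v)) + f * rho (inner n v v)) ->
    0 <= rho (inner n v (mvec n X v)) + e * rho (inner n v v)).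
  { intros u e H. apply Rnot_lt_le. intros Hlt. pose proof (rho_inner_ge0 n u) as HN.
    set (q := rho (inner n u (mvec n X u))) in *. set (N := rho (inner n u u)) in *.
    (* With this [d], $q + eN = -2d(N+1)$, so $q + (e+d)N$ is still negative. *)
    set (d := (- (q + e * N) / (2 * (N + 1)))%R).
    assert (Hd : 0 < d) by (apply Rdiv_lt_0_compat; lra).
    specialize (H (e + d)%R ltac:(lra)).
    assert (d * (2 * (N + 1)) = - (q + e * N))%R by (unfold d; field; lra).
    nra. }
  assert (H : forall e, 0 < e ->
    forall v, 0 <= rho (inner n v (mvec n X v)) + e * rho (inner n v v)).
  2: { specialize (Hlim v 0%R). rewrite Rmult_0_l, Rplus_0_r in Hlim. apply Hlim.
       intros; auto. }
  apply (real_continuation (fun e => forall v,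
    0 <= rho (inner n v (mvec n X v)) + e * rho (inner n v v))).
  - destruct (rho_matrix_bounded n X) as (M & HM & H). exists M. intros u.
    specialize (H u). apply Rabs_le_elim in H. lra.
  - intros e f Hef H u. specialize (H u). pose proof (rho_inner_ge0 n u). nra.
  - intros e He H.
    assert (Q : forall u, 0 <= rho (inner n u (mvec n X u)) + e * rho (inner n u u)).
    { intros u. apply Hlim. intros; auto. }
    set (B := fun i j => X i j + smul (Copp (rc (- e))) (mid A i j)).
    assert (Inv : minvertible A n B).
    { apply NNPP. intros N. destruct (Hspec _ N) as [_ Hre]. cbn in Hre. lra. }
    destruct Inv as (Y & HY & _).
    assert (QB : forall u, rho (inner n u (mvec n B u)) =
                           (rho (inner n u (mvec n X u)) + e * rho (inner n u u))%R).
    { intros u. rewrite <- rho_scal, <- rho_add, <- inner_addr. f_equal.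
      apply inner_ext; auto. intros i Hi. unfold B. rewrite mvec_shift by auto. nc. }
    assert (HB : meq A n (mstar A B) B).
    { intros i j Hi Hj. unfold mstar, B. rewrite <- (HX i j) by auto. unfold mstar, mid.
      rewrite (Nat.eqb_sym i j). destruct (Nat.eqb j i); star_nc. }
    destruct (rho_matrix_bounded n Y) as (M & HM & HYb).
    (* The sandwich yields $-2kN + k^2T$ with $T \le MN$; this choice gives $k^2T \le kN$, so that
       $e$ can be lowered by [k]. *)
    set (k := (/ (M + 1))%R).
    assert (Hk : 0 < k) by (apply Rinv_0_lt_compat; lra).
    assert (HkM : (k * (M + 1))%R = 1%R) by (unfold k; field; lra).
    exists k. split; auto. intros u.
    set (w := mvec n Y u).
    pose proof (inner_sandwich n B u w k HB) as E.
    specialize (E (fun i Hi => mvec_inverse n B Y u i HY Hi)). cbv zeta in E.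
    pose proof (Q (fun i => u i + (- k) *: w i)) as Q'. rewrite <- QB, E in Q'.
    rewrite !rho_add, !rho_scal, QB in Q'.
    rewrite <- (inner_star n u w), rho_star in Q'.
    specialize (HYb u). fold w in HYb. apply Rabs_le_elim in HYb.
    pose proof (rho_inner_ge0 n u).
    set (N := rho (inner n u u)) in *. set (T := rho (inner n u w)) in *.
    assert (k * k * T <= k * N).
    { apply Rle_trans with (k * (k * (M * N)))%R; [nra|]. apply Rmult_le_compat_l; nra. }
    lra.
Qed.

Lemma csum_ext n (f g : nat -> Cplx) :
  (forall i, (i < n)%nat -> f i = g i) -> csum n f = csum n g.
Proof.
  induction n as [|n IH]; cbn; intros H; auto.
  rewrite H by lia. rewrite IH by (intros; apply H; lia). reflexivity.
Qed.

Lemma state_completely_positive : completely_positive A phi.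
Proof.
  intros n X HX c. cbv zeta.
  (* Multiples of [one] as vector entries turn the scalar quadratic form into the value of [phi] at
     a module inner product. *)
  set (v := fun i => smul (c i) (one : A)).
  assert (E : csum n (fun i => csum n (fun j => Cmul (Cconj (c i)) (Cmul (phi (X i j)) (c j))))
              = phi (inner n v (mvec n X v))).
  { unfold inner. rewrite (linear_asum phi) by apply Hphi. apply csum_ext. intros i Hi.
    unfold mvec. rewrite <- asum_mull, (linear_asum phi) by apply Hphi.
    apply csum_ext. intros j Hj. unfold v.
    replace (star (smul (c i) one) * (X i j * smul (c j) one))
      with (smul (Cmul (Cconj (c i)) (c j)) (X i j)) by star_nc.
    rewrite (proj2 (proj1 Hphi)). cplx_arith. }
  rewrite E. split.
  - assert (S0 : star (inner n v (mvec n X v)) = inner n v (mvec n X v)).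
    { rewrite inner_star. apply inner_mvec_sa, HX. }
    apply state_sa; auto.
  - apply (rho_mpositive n X v HX).
Qed.

End Vectors.

Lemma state_ucp (A : CStarAlgebra) (phi : A -> Cplx) : state A phi -> ucp A phi.
Proof.
  intros H. split; [apply H|]. split; [apply H|]. apply state_completely_positive; auto.
Qed.

Lemma ucp_state (A : CStarAlgebra) (phi : A -> Cplx) : ucp A phi -> state A phi.
Proof.
  intros (Hlin & H1 & Hcp). split; auto. split; auto. intros a [Ha Hs].
  assert (M : mpositive A 1 (fun _ _ => a)).
  { split.
    - intros i j _ _. exact Ha.
    - intros l N. apply Hs. intros (y & Hy1 & Hy2). apply N.
      exists (fun _ _ => y).
      split; intros i j Hi Hj; replace i with 0%nat by lia; replace j with 0%nat by lia;
        unfold mmul, mid; cbn; rewrite add0; auto. }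
  specialize (Hcp 1%nat _ M (fun _ => C1)). cbn in Hcp. split; lra.
Qed.

(** * The Hahn-Banach theorem *)

(** Kept abstract because the theorem is applied both to the algebra and to pairs of its
    elements. *)
Record real_space := {
  vec :> Type;
  vzero : vec;
  vadd : vec -> vec -> vec;
  vscal : R -> vec -> vec;
  vaddA : forall x y z, vadd x (vadd y z) = vadd (vadd x y) z;
  vaddC : forall x y, vadd x y = vadd y x;
  vadd0 : forall x, vadd vzero x = x;
  vscal0 : forall x, vscal 0 x = vzero;
  vscal1 : forall x, vscal 1 x = x;
  vscalA : forall a b x, vscal a (vscal b x) = vscal (a * b) x;
  vscalDr : forall a x y, vscal a (vadd x y) = vadd (vscal a x) (vscal a y);
  vscalDl : forall a b x, vscal (a + b) x = vadd (vscal a x) (vscal b x)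
}.
Arguments vzero {_}. Arguments vadd {_}. Arguments vscal {_}.

Section HahnBanach.
Variable V : real_space.
Implicit Types (x y v : V) (K : V * R -> Prop).

Lemma vadd_scal_sub x : vadd (vscal (-1) x) x = vzero.
Proof.
  rewrite <- (vscal1 V x) at 2. rewrite <- vscalDl, <- (vscal0 V x). f_equal; ring.
Qed.

(* Epigraph-like cones: a cone stands for the family of constraints [F x <= r]. *)
Definition proper_cone K : Prop :=
  K (vzero, 0) /\
  (forall x r y s, K (x, r) -> K (y, s) -> K (vadd x y, r + s)) /\
  (forall t x r, 0 < t -> K (x, r) -> K (vscal t x, t * r)) /\
  (forall r, K (vzero, r) -> 0 <= r).

Lemma proper_cone_maximal K0 : proper_cone K0 ->
  exists K, proper_cone K /\ (forall p, K0 p -> K p) /\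
    forall K', proper_cone K' -> (forall p, K p -> K' p) -> forall p, K' p -> K p.
Proof.
  intros H0.
  set (P := fun K => (forall p, ~ K p) \/ ((forall p, K0 p -> K p) /\ proper_cone K)).
  destruct (classical_sets.Zorn_bigcup (P := P)) as (K & PK & Kmax).
  - intros F FP Ftot. unfold classical_sets.bigcup, classical_sets.mkset.
    destruct (classic (exists X, F X /\ exists p, X p)) as [(X & FX & p0 & Xp)|N].
    2: { left. intros p [X FX Xp]. apply N. eauto. }
    right.
    assert (Fgood : forall Y p, F Y -> Y p -> (forall p, K0 p -> Y p) /\ proper_cone Y).
    { intros Y p FY Yp. destruct (FP Y FY) as [E|G]; [destruct (E p Yp)|auto]. }
    destruct (Fgood X p0 FX Xp) as [K0X [X0 _]]. repeat split.
    + intros p Hp. exists X; auto.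
    + exists X; auto.
    + intros x r y s [Y FY Yx] [Z FZ Zy].
      destruct (Ftot Y Z FY FZ) as [S|S].
      * exists Z; auto. destruct (Fgood Z _ FZ Zy) as [_ (_ & C & _)]. apply C; auto.
      * exists Y; auto. destruct (Fgood Y _ FY Yx) as [_ (_ & C & _)]. apply C; auto.
    + intros t x r Ht [Y FY Yx]. exists Y; auto.
      destruct (Fgood Y _ FY Yx) as [_ (_ & _ & C & _)]. apply C; auto.
    + intros r [Y FY Yx]. destruct (Fgood Y _ FY Yx) as [_ (_ & _ & _ & C)]. apply C; auto.
  - assert (Kgood : (forall p, K0 p -> K p) /\ proper_cone K).
    { destruct PK as [E|G]; auto. exfalso. apply (Kmax K0).
      - split.
        + intros p Hp. destruct (E p Hp).
        + intros S. apply (E (vzero, 0)), S, H0.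
      - right. auto. }
    destruct Kgood as [G1 G2]. exists K. split; [auto|split; [auto|]].
    intros K' C' S p Hp. apply NNPP. intros N. apply (Kmax K').
    + split; [exact S|]. intros S'. apply N, S', Hp.
    + right. auto.
Qed.

(* In a maximal cone the infimum [q] of the bounds at [v] satisfies [K (-v, -q)]:
   otherwise adding this ray would give a larger proper cone. *)
Lemma maximal_cone_value K v : proper_cone K -> (forall x, exists r, K (x, r)) ->
  (forall K', proper_cone K' -> (forall p, K p -> K' p) -> forall p, K' p -> K p) ->
  { q : R | ((forall r, K (v, r) -> q <= r) /\
              (forall c, (forall r, K (v, r) -> c <= r) -> c <= q)) /\
            K (vscal (-1) v, - q) }.
Proof.
  intros (C0 & Cadd & Cscal & Cpos) Tot Max.
  destruct (completeness (fun r => K (v, - r))) as [m [Hub Hlub]].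
  - destruct (Tot (vscal (-1) v)) as [s Hs]. exists s. intros r Hr.
    pose proof (Cadd _ _ _ _ Hs Hr) as H. rewrite vadd_scal_sub in H.
    apply Cpos in H. lra.
  - destruct (Tot v) as [r Hr]. exists (- r). rewrite Ropp_involutive; auto.
  - exists (- m).
    assert (Hq : forall r, K (v, r) -> - m <= r).
    { intros r Hr. assert (- r <= m); [|lra]. apply Hub. rewrite Ropp_involutive; auto. }
    split; [split; auto|].
    { intros c Hc. assert (m <= - c); [|lra]. apply Hlub. intros r Hr. apply Hc in Hr. lra. }
    apply (Max (fun p => exists t, 0 <= t /\
                  K (vadd (fst p) (vscal t v), snd p + t * (- m)))).
    + repeat split; cbn [fst snd].
      * exists 0. split; [lra|]. rewrite vscal0, vadd0. replace (0 + 0 * - m) with 0 by ring.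
        auto.
      * intros x r y s (t & Ht & Kx) (u & Hu & Ky). exists (t + u). split; [lra|].
        replace (vadd (vadd x y) (vscal (t + u) v))
          with (vadd (vadd x (vscal t v)) (vadd y (vscal u v))).
        { replace (r + s + (t + u) * - m) with ((r + t * - m) + (s + u * - m)) by ring.
          auto. }
        rewrite vscalDl, <- !vaddA. f_equal. rewrite !vaddA. f_equal. apply vaddC.
      * intros t x r Ht (u & Hu & Kx). exists (t * u). split; [nra|].
        rewrite <- vscalA, <- vscalDr.
        replace (t * r + t * u * - m) with (t * (r + u * - m)) by ring. auto.
      * intros r (t & Ht & Kt). rewrite vadd0 in Kt.
        destruct (Rle_lt_or_eq_dec 0 t Ht) as [Ht'|<-].
        -- apply (Cscal (/ t)) in Kt; [|apply Rinv_0_lt_compat; auto].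
           rewrite vscalA, Rinv_l, vscal1 in Kt by lra. apply Hq in Kt.
           apply Rmult_le_compat_l with (r := t) in Kt; [|lra].
           replace (t * (/ t * (r + t * - m))) with (r + t * - m) in Kt by (field; lra).
           lra.
        -- rewrite vscal0 in Kt. apply Cpos in Kt. lra.
    + intros [x r] Hp. exists 0. split; [lra|]. cbn [fst snd].
      rewrite vscal0, vaddC, vadd0. replace (r + 0 * - m) with r by ring. auto.
    + exists 1. split; [lra|]. cbn [fst snd]. rewrite vscal1, vadd_scal_sub.
      replace (- - m + 1 * - m) with 0 by ring. auto.
Qed.

(** In a maximal cone the least bound [F x] is attained and $(-x, -F(x))$ also belongs to the cone.
    Adding such members gives both inequalities of additivity. *)
Theorem hahn_banach K0 : proper_cone K0 -> (forall x, exists r, K0 (x, r)) ->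
  exists F : V -> R,
    (forall x y, F (vadd x y) = F x + F y) /\
    (forall t x, F (vscal t x) = t * F x) /\
    (forall x r, K0 (x, r) -> F x <= r).
Proof.
  intros H0 Tot0.
  destruct (proper_cone_maximal K0 H0) as (K & CK & Sub & Max).
  assert (Tot : forall x, exists r, K (x, r)).
  { intros x. destruct (Tot0 x) as [r Hr]. eauto. }
  set (F := fun v => proj1_sig (maximal_cone_value K v CK Tot Max)).
  assert (F1 : forall x r, K (x, r) -> F x <= r).
  { intros x. exact (proj1 (proj1 (proj2_sig (maximal_cone_value K x CK Tot Max)))). }
  assert (Fglb : forall x c, (forall r, K (x, r) -> c <= r) -> c <= F x).
  { intros x. exact (proj2 (proj1 (proj2_sig (maximal_cone_value K x CK Tot Max)))). }
  assert (F2 : forall x, K (vscal (-1) x, - F x)).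
  { intros x. exact (proj2 (proj2_sig (maximal_cone_value K x CK Tot Max))). }
  destruct CK as (C0 & Cadd & Cscal & Cpos).
  assert (neg2 : forall x, vscal (-1) (vscal (-1) x) = x).
  { intros x. rewrite vscalA. replace (-1 * -1) with 1 by ring. apply vscal1. }
  assert (F3 : forall x, K (x, - F (vscal (-1) x))).
  { intros x. pose proof (F2 (vscal (-1) x)) as H. rewrite neg2 in H. auto. }
  assert (Fneg : forall x, F (vscal (-1) x) = - F x).
  { intros x. pose proof (F1 _ _ (F2 x)).
    assert (- F (vscal (-1) x) <= F x); [|lra].
    apply Fglb. intros r Hr. assert (- r <= F (vscal (-1) x)); [|lra].
    apply Fglb. intros s Hs. pose proof (Cadd _ _ _ _ Hs Hr) as H'.
    rewrite vadd_scal_sub in H'. apply Cpos in H'. lra. }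
  assert (FK : forall x, K (x, F x)).
  { intros x. replace (F x) with (- F (vscal (-1) x)) by (rewrite Fneg; ring). auto. }
  assert (Fadd : forall x y, F (vadd x y) = F x + F y).
  { intros x y. pose proof (F1 _ _ (Cadd _ _ _ _ (FK x) (FK y))).
    pose proof (F1 _ _ (Cadd _ _ _ _ (FK (vadd x y)) (FK (vscal (-1) y)))) as H1.
    rewrite Fneg, <- vaddA, (vaddC V y), vadd_scal_sub, vaddC, vadd0 in H1. lra. }
  assert (Fle : forall t x, 0 < t -> F (vscal t x) <= t * F x).
  { intros t x Ht. apply F1, Cscal; auto. }
  assert (Fpos : forall t x, 0 < t -> F (vscal t x) = t * F x).
  { intros t x Ht. pose proof (Fle t x Ht).
    pose proof (Fle t (vscal (-1) x) Ht) as H'.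
    rewrite vscalA, (Rmult_comm t), <- vscalA, !Fneg in H'. lra. }
  exists F. repeat split; auto.
  intros t x. destruct (Rtotal_order t 0) as [Ht|[->|Ht]]; auto.
  - replace t with (-1 * - t) at 1 by ring. rewrite <- vscalA, Fneg, Fpos by lra. ring.
  - rewrite vscal0. pose proof (Fadd vzero vzero) as H. rewrite vadd0 in H. lra.
Qed.

End HahnBanach.

(** * Norming functionals and Jordan decompositions *)

Ltac splits := repeat match goal with |- _ /\ _ => split end.

Section Extensions.
Context {A : CStarAlgebra}.
Implicit Types x y z s : A.
Local Open Scope cstar_scope.

Definition algebra_space : real_space.
Proof.
  refine {| vec := A; vzero := zero; vadd := add; vscal := fun r x => r *: x |};
    intros; nc.
Defined.

Definition pair_space : real_space.
Proof.
  refine {| vec := (A * A)%type; vzero := (zero, zero);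
            vadd := fun x y : (A * A)%type => (fst x + fst y, snd x + snd y);
            vscal := fun r (x : (A * A)%type) => (r *: fst x, r *: snd x) |};
    intros; repeat match goal with x : (_ * _)%type |- _ => destruct x end;
    cbn [fst snd]; f_equal; nc.
Defined.

(** The cone encodes the sublinear functional $x \mapsto \inf_t (\|x - ts\| + t\|s\|)$. Its value at
    $-s$ is at most $-\|s\|$, which forces $F(s) \ge \|s\|$, and $t = 0$ gives $F \le \|\cdot\|$. *)
Lemma norming_functional s :
  exists F : A -> R, real_linear F /\ F s = norm s /\ forall x, F x <= norm x.
Proof.
  destruct (hahn_banach algebra_space
    (fun p => exists t, norm (fst p - t *: s) + t * norm s <= snd p))
    as (F & Fadd & Fscal & Fle).
  - repeat split; cbn [fst snd vzero vadd vscal algebra_space].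
    + exists 0%R. replace (zero - 0 *: s) with (zero : A) by nc. rewrite norm_zero. lra.
    + intros x r y u [t Ht] [t' Ht']. exists (t + t')%R.
      replace (x + y - (t + t') *: s) with ((x - t *: s) + (y - t' *: s)) by nc.
      pose proof (norm_triangle A (x - t *: s) (y - t' *: s)). lra.
    + intros k x r Hk [t Ht]. exists (k * t)%R.
      replace (k *: x - (k * t) *: s) with (k *: (x - t *: s)) by nc.
      rewrite norm_rc_pos by lra. nra.
    + intros r [t Ht]. replace (zero - t *: s) with ((- t) *: s) in Ht by nc.
      rewrite norm_rc in Ht. pose proof (Rle_abs (- t)). pose proof (norm_ge0 A s). nra.
  - intros x. exists (norm x). exists 0%R. cbn.
    replace (x - 0 *: s) with x by nc. lra.
  - exists F. split; [split; auto|].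
    assert (Fn : forall x, F x <= norm x).
    { intros x. apply Fle. exists 0%R. cbn. replace (x - 0 *: s) with x by nc. lra. }
    split; auto. apply Rle_antisym; auto.
    assert (H : F ((-1) *: s) <= - norm s).
    { apply Fle. exists (-1)%R. cbn.
      replace (-1 *: s - -1 *: s) with (zero : A) by nc. rewrite norm_zero. lra. }
    pose proof (Fscal (-1)%R s) as H'. cbn in H'. lra.
Qed.

(* Hahn-Banach on [A * A] for the sublinear functional
   [(x, y) |-> max 0 (sup spec x) (sup spec y)], extending [(s, -s) |-> L s]. *)
Lemma jordan_extension (S : A -> Prop) (L : A -> R) :
  operator_system A S ->
  (forall x y, S x -> S y -> L (x + y) = (L x + L y)%R) ->
  (forall r x, S x -> L (r *: x) = (r * L x)%R) ->
  (forall x, S x -> star x = x -> Rabs (L x) <= norm x) ->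
  exists F1 F2 : A -> R,
    real_linear F1 /\ real_linear F2 /\
    (forall x, pos x -> 0 <= F1 x) /\ (forall x, pos x -> 0 <= F2 x) /\
    (F1 one + F2 one <= 1)%R /\
    (forall x, S x -> star x = x -> L x = (F1 x - F2 x)%R).
Proof.
  intros (S1 & Sadd & Sscal & Sstar) Ladd Lscal Lnorm.
  assert (S0 : S zero).
  { replace (zero : A) with (0 *: (one : A)) by nc. auto. }
  assert (L0 : L zero = 0%R).
  { replace (zero : A) with (0 *: (one : A)) by nc. rewrite Lscal by auto. ring. }
  assert (readd : forall x y, re_part (x + y) = re_part x + re_part y)
    by (intros; unfold re_part; star_nc).
  assert (rescal : forall r x, re_part (r *: x) = r *: re_part x)
    by (intros; unfold re_part; star_nc).
  (* A pair dominated by $(s, -s) + t(1, 1)$ is bounded by $L(s) + t$. Real parts extend the order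
     constraints to arbitrary elements. *)
  set (K := fun p : pair_space * R => exists s t, S s /\ star s = s /\ 0 <= t /\
    pos (t *: one - (re_part (fst (fst p)) - s)) /\
    pos (t *: one - (re_part (snd (fst p)) + s)) /\ (t + L s <= snd p)%R).
  assert (re0 : re_part (zero : A) = zero) by (apply re_part_of_sa, star_zero).
  destruct (hahn_banach pair_space K) as (F & Fadd & Fscal & Fle).
  - unfold K. unfold proper_cone; splits; cbn [fst snd vzero vadd vscal pair_space].
    + exists zero, 0%R. rewrite re0, L0. splits; auto using star_zero; try lra.
      * replace (0 *: one - ((zero : A) - zero)) with (zero : A) by nc. apply pos_zero.
      * replace (0 *: one - ((zero : A) + zero)) with (zero : A) by nc. apply pos_zero.
    + intros [x1 x2] r [y1 y2] r' (s & t & Ss & Hs & Ht & P1 & P2 & Hr)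
        (s' & t' & Ss' & Hs' & Ht' & P1' & P2' & Hr'). cbn [fst snd] in *.
      exists (s + s'), (t + t')%R. rewrite !readd.
      splits; auto; [star_nc | nra | | |].
      * replace ((t + t') *: one - (re_part x1 + re_part y1 - (s + s')))
          with ((t *: one - (re_part x1 - s)) + (t' *: one - (re_part y1 - s'))) by nc.
        apply pos_add; auto.
      * replace ((t + t') *: one - (re_part x2 + re_part y2 + (s + s')))
          with ((t *: one - (re_part x2 + s)) + (t' *: one - (re_part y2 + s'))) by nc.
        apply pos_add; auto.
      * rewrite Ladd by auto. lra.
    + intros k [x1 x2] r Hk (s & t & Ss & Hs & Ht & P1 & P2 & Hr). cbn [fst snd] in *.
      exists (k *: s), (k * t)%R. rewrite !rescal.
      splits; auto; [star_nc | nra | | |].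
      * replace ((k * t) *: one - (k *: re_part x1 - k *: s))
          with (k *: (t *: one - (re_part x1 - s))) by nc.
        apply pos_scal; auto; lra.
      * replace ((k * t) *: one - (k *: re_part x2 + k *: s))
          with (k *: (t *: one - (re_part x2 + s))) by nc.
        apply pos_scal; auto; lra.
      * rewrite Lscal by auto. nra.
    + intros r (s & t & Ss & Hs & Ht & P1 & P2 & Hr). rewrite re0 in P1, P2.
      replace (t *: one - (zero - s)) with (t *: one + s) in P1 by nc.
      replace (t *: one - (zero + s)) with (t *: one - s) in P2 by nc.
      (* The constraints say $-t \le s \le t$, so $|L(s)| \le \|s\| \le t$ and the bound is
         nonnegative. *)
      specialize (Lnorm s Ss Hs). apply Rabs_le_elim in Lnorm.
      pose proof (norm_le_of_pos s t Hs Ht P2 P1). lra.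
  - intros [x y]. set (u := re_part x). set (v := re_part y).
    pose proof (norm_ge0 A u). pose proof (norm_ge0 A v).
    exists (norm u + norm v)%R, zero, (norm u + norm v)%R. rewrite L0. cbn [fst snd].
    fold u v. splits; auto using star_zero; try lra.
    + replace ((norm u + norm v) *: one - (u - zero))
        with ((norm u *: one - u) + norm v *: one) by nc.
      apply pos_add; [apply pos_norm_sub, re_part_sa|apply pos_scalar; auto].
    + replace ((norm u + norm v) *: one - (v + zero))
        with ((norm v *: one - v) + norm u *: one) by nc.
      apply pos_add; [apply pos_norm_sub, re_part_sa|apply pos_scalar; auto].
  - cbn [vec vadd vscal pair_space fst snd] in F, Fadd, Fscal, Fle.
    exists (fun x => F (x, zero)), (fun x => F (zero, x)).
    assert (Fsplit : forall x y, F (x, y) = (F (x, zero) + F (zero, y))%R).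
    { intros x y. rewrite <- (Fadd (x, zero) (zero, y)). cbn [fst snd].
      f_equal; f_equal; nc. }
    assert (Fneg : forall x y, F ((-1) *: x, (-1) *: y) = (- F (x, y))%R).
    { intros x y. pose proof (Fscal (-1)%R (x, y)) as H. cbn [fst snd] in H.
      rewrite H. ring. }
    assert (Fdiag : forall x, S x -> star x = x -> F (x, (-1) *: x) <= L x).
    { intros x Sx Hx. apply Fle. exists x, 0%R. cbn [fst snd].
      rewrite rescal, re_part_of_sa by auto. splits; auto; try lra.
      - replace (0 *: one - (x - x)) with (zero : A) by nc. apply pos_zero.
      - replace (0 *: one - ((-1) *: x + x)) with (zero : A) by nc. apply pos_zero. }
    unfold real_linear; splits.
    + intros x y. rewrite <- (Fadd (x, zero) (y, zero)). cbn [fst snd]. f_equal; f_equal; nc.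
    + intros r x. rewrite <- (Fscal r (x, zero)). cbn [fst snd]. f_equal; f_equal; nc.
    + intros x y. rewrite <- (Fadd (zero, x) (zero, y)). cbn [fst snd]. f_equal; f_equal; nc.
    + intros r x. rewrite <- (Fscal r (zero, x)). cbn [fst snd]. f_equal; f_equal; nc.
    (* For positive $x$ the pair $(-x, 0)$ already satisfies the constraints with $s = 0$ and $t =
       0$. *)
    + intros x Px. enough (F ((-1) *: x, (-1) *: zero) <= 0) by (rewrite Fneg in *; lra).
      apply Fle. exists zero, 0%R. cbn [fst snd].
      rewrite !rescal, re0, re_part_of_sa, L0 by apply Px.
      splits; auto using star_zero; try lra.
      * replace (0 *: one - ((-1) *: x - zero)) with x by nc. auto.
      * replace (0 *: one - ((-1) *: (zero : A) + zero)) with (zero : A) by nc. apply pos_zero.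
    + intros x Px. enough (F ((-1) *: zero, (-1) *: x) <= 0) by (rewrite Fneg in *; lra).
      apply Fle. exists zero, 0%R. cbn [fst snd].
      rewrite !rescal, re0, re_part_of_sa, L0 by apply Px.
      splits; auto using star_zero; try lra.
      * replace (0 *: one - ((-1) *: (zero : A) - zero)) with (zero : A) by nc. apply pos_zero.
      * replace (0 *: one - ((-1) *: x + zero)) with x by nc. auto.
    + rewrite <- Fsplit. apply Fle. exists zero, 1%R. cbn [fst snd].
      rewrite re_part_of_sa, L0 by apply star_one.
      splits; auto using star_zero; try lra.
      * replace (1 *: one - ((one : A) - zero)) with (zero : A) by nc. apply pos_zero.
      * replace (1 *: one - ((one : A) + zero)) with (zero : A) by nc. apply pos_zero.
    (* The bound at $(x, -x)$, used for $x$ and for $-x$, becomes an equality. *)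
    + intros x Sx Hx. pose proof (Fdiag x Sx Hx) as H1.
      assert (H2 : F ((-1) *: x, (-1) *: ((-1) *: x)) <= L ((-1) *: x)).
      { apply Fdiag; auto. star_nc. }
      rewrite Fneg, Lscal in H2 by auto. rewrite Fsplit in H1, H2.
      assert (E : F (zero, (-1) *: x) = (- F (zero, x))%R).
      { rewrite <- Fneg. f_equal; f_equal; nc. }
      rewrite E in H1, H2. lra.
Qed.

End Extensions.

(** * Peaking states *)

Section Peaking.
Context {A : CStarAlgebra}.
Implicit Types x y : A.
Local Open Scope cstar_scope.

Lemma complexify_state (F : A -> R) : real_linear F -> (forall x, pos x -> 0 <= F x) ->
  F one = 1%R -> state A (complexify F).
Proof.
  intros HF Fpos F1. split; [apply complexify_linear; auto|]. split.
  - rewrite complexify_sa, F1 by (auto using star_one). reflexivity.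
  - intros a Ha. apply positive_pos in Ha.
    rewrite complexify_sa by (auto; apply Ha). cbn. auto.
Qed.

(** Both $\|x\| - x$ and $\|x\| + x$ are positive. *)
Lemma positive_functional_bound (F : A -> R) x : real_linear F ->
  (forall x, pos x -> 0 <= F x) -> star x = x -> Rabs (F x) <= F one * norm x.
Proof.
  intros [Fadd Fscal] Fpos Hx.
  assert (H : forall y, star y = y -> F y <= F one * norm y).
  { intros y Hy. pose proof (Fpos _ (pos_norm_sub y Hy)) as H.
    replace (norm y *: one - y) with (norm y *: one + (-1) *: y) in H by nc.
    rewrite Fadd, !Fscal in H. lra. }
  apply Rabs_le. split; [|auto].
  specialize (H ((-1) *: x)). rewrite Fscal, norm_rc, Rabs_left in H by lra.
  assert (S0 : star ((-1) *: x) = (-1) *: x) by star_nc. specialize (H S0). lra.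
Qed.

Lemma state_Q_sa_ball (S : A -> Prop) (phi : A -> Cplx) :
  state A phi -> Q_sa_ball A S phi.
Proof.
  intros H. repeat split; intros.
  - apply H.
  - apply H.
  - apply state_star; auto.
  - apply state_bound; auto.
Qed.

Lemma opp_Q_sa_ball (S : A -> Prop) (L : A -> Cplx) :
  Q_sa_ball A S L -> Q_sa_ball A S (fun x => Copp (L x)).
Proof.
  intros (Ladd & Lscal & Lstar & Lnorm). repeat split; intros.
  - rewrite Ladd by auto. cplx_arith.
  - rewrite Lscal by auto. cplx_arith.
  - rewrite Lstar by auto. cplx_arith.
  - specialize (Lnorm x H). revert Lnorm. unfold Cabs; cbn. rewrite !Rmult_opp_opp. auto.
Qed.

Lemma Q_sa_ball_re_part (S : A -> Prop) (L : A -> Cplx) x :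
  operator_system A S -> Q_sa_ball A S L -> S x -> L (re_part x) = rc (Cre (L x)).
Proof.
  intros (_ & Sadd & _ & Sstar) (Ladd & Lscal & Lstar & _) Hx.
  unfold re_part. rewrite Lscal, Ladd, Lstar by auto. cplx_arith.
Qed.

Lemma Q_sa_ball_im_part (S : A -> Prop) (L : A -> Cplx) x :
  operator_system A S -> Q_sa_ball A S L -> S x -> L (im_part x) = rc (Cim (L x)).
Proof.
  intros (_ & Sadd & Sscal & Sstar) (Ladd & Lscal & Lstar & _) Hx. unfold im_part.
  replace (x - star x) with (x + (-1) *: star x) by nc.
  rewrite Lscal, Ladd, Lscal, Lstar by auto. cplx_arith.
Qed.

Lemma peaking_value (psi : A -> Cplx) s :
  (forall phi, state A phi -> (exists a, phi a <> psi a) -> Cabs (phi s) < 1) ->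
  forall phi, state A phi -> 1 <= Cabs (phi s) -> forall a, phi a = psi a.
Proof.
  intros H phi Hphi H1 a. apply NNPP. intros N.
  specialize (H phi Hphi (ex_intro _ a N)). lra.
Qed.

(* A norm-one hermitian functional attaining its norm at the peaking element has a Jordan
   decomposition whose parts both peak there, so that its negative part vanishes. *)
Lemma peaking_exposed (S : A -> Prop) (psi : A -> Cplx) s (L : A -> Cplx) :
  operator_system A S -> state A psi -> S s -> star s = s -> norm s = 1%R ->
  psi s = C1 ->
  (forall phi, state A phi -> (exists a, phi a <> psi a) -> Cabs (phi s) < 1) ->
  Q_sa_ball A S L -> 1 <= Cre (L s) -> funct_eq_on A S L psi.
Proof.
  intros HS Hpsi Ss Hs Ns Ps Peak QL L1.
  pose proof QL as (Ladd & Lscal & Lstar & Lnorm).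
  destruct (jordan_extension S (fun x => Cre (L x)))
    as (F1 & F2 & lin1 & lin2 & pos1 & pos2 & le1 & LF); auto.
  { intros x y Hx Hy. rewrite Ladd by auto. reflexivity. }
  { intros r x Hx. rewrite Lscal by auto. cbn; ring. }
  { intros x Hx _. eapply Rle_trans; [apply Cre_le_Cabs|auto]. }
  (* From $F_1(s) - F_2(s) \ge 1 \ge F_1(1) + F_2(1)$ and $|F_i(s)| \le F_i(1)$ it follows that
     $F_1(s) = F_1(1)$ and $F_2(s) = -F_2(1)$. *)
  pose proof (positive_functional_bound F1 s lin1 pos1 Hs) as B1.
  pose proof (positive_functional_bound F2 s lin2 pos2 Hs) as B2.
  rewrite Ns, Rmult_1_r in B1, B2. apply Rabs_le_elim in B1, B2.
  pose proof (LF s Ss Hs) as LFs. cbv beta in LFs.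
  (* Otherwise [F2], normalised, is a state with value $-1$ at [s], hence equal to [psi], although
     [psi s] is $1$. *)
  assert (b0 : F2 one = 0%R).
  { apply NNPP. intros Hb. assert (Hb' : 0 < F2 one) by lra.
    set (G := fun x => (/ F2 one * F2 x)%R).
    assert (linG : real_linear G).
    { destruct lin2 as [a2 s2]. unfold G. split; intros; [rewrite a2|rewrite s2]; ring. }
    assert (StG : state A (complexify G)).
    { apply complexify_state; auto.
      - intros x Px. unfold G. apply Rmult_le_pos; auto.
        apply Rlt_le, Rinv_0_lt_compat; auto.
      - unfold G. field; lra. }
    assert (Gs : complexify G s = rc (-1)).
    { rewrite complexify_sa by auto. unfold G.
      replace (F2 s) with (- F2 one)%R by lra. f_equal. field; lra. }
    assert (E : complexify G s = psi s).
    { apply (peaking_value psi s Peak); auto. rewrite Gs, Cabs_rc, Rabs_left; lra. }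
    rewrite Gs, Ps in E. apply (f_equal Cre) in E. cbn in E. lra. }
  assert (St1 : state A (complexify F1)).
  { apply complexify_state; auto. lra. }
  assert (E1 : forall x, complexify F1 x = psi x).
  { apply (peaking_value psi s Peak); auto.
    rewrite complexify_sa by auto. replace (F1 s) with 1%R by lra.
    rewrite Cabs_rc, Rabs_R1; lra. }
  assert (Ere : forall x, S x -> star x = x -> Cre (L x) = Cre (psi x)).
  { intros x Sx Hx. rewrite (LF x Sx Hx), <- E1, complexify_sa by auto. cbn.
    pose proof (positive_functional_bound F2 x lin2 pos2 Hx) as B.
    rewrite b0, Rmult_0_l in B. apply Rabs_le_elim in B. lra. }
  pose proof (state_Q_sa_ball S psi Hpsi) as Qpsi.
  pose proof HS as (S1 & Sadd & Sscal & Sstar).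
  intros x Sx. apply Cplx_ext.
  - pose proof (Q_sa_ball_re_part S L x HS QL Sx) as H1.
    pose proof (Q_sa_ball_re_part S psi x HS Qpsi Sx) as H2.
    assert (H : Cre (L (re_part x)) = Cre (psi (re_part x))).
    { apply Ere; [|apply re_part_sa]. unfold re_part; auto. }
    rewrite H1, H2 in H. exact H.
  - pose proof (Q_sa_ball_im_part S L x HS QL Sx) as H1.
    pose proof (Q_sa_ball_im_part S psi x HS Qpsi Sx) as H2.
    assert (H : Cre (L (im_part x)) = Cre (psi (im_part x))).
    { apply Ere; [|apply im_part_sa]. unfold im_part. apply Sscal, Sadd; auto.
      rewrite opp_smul; auto. }
    rewrite H1, H2 in H. exact H.
Qed.

Lemma C1_neq_C0 : C1 <> C0.
Proof. intros H. apply (f_equal Cre) in H. cbn in H. lra. Qed.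

End Peaking.

Theorem theorem3p2 (A : CStarAlgebra) (S : A -> Prop) (psi : A -> Cplx)
  (hS : operator_system A S) (hpsi : state A psi) :
  S_peaking A S psi <->
  (unique_extension_property A S psi /\ weak_star_exposed A S (Q_sa_ball A S) psi).
Proof.
  split.
  - intros (s & Ss & Hs & Ns & Ps & Peak). split; [split|split; [|split]].
    + apply state_ucp; auto.
    + intros Phi HPhi Ext. apply (peaking_value psi s Peak).
      * apply ucp_state; auto.
      * rewrite Ext, Ps by auto. change C1 with (rc 1). rewrite Cabs_rc, Rabs_R1; lra.
    + apply state_Q_sa_ball; auto.
    + exists s. split; auto. rewrite Ps. apply C1_neq_C0.
    + exists s. split; auto. split; [rewrite Ps; reflexivity|].
      intros L QL NL. apply Rnot_le_lt. intros H. apply NL.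
      apply (peaking_exposed S psi s); auto.
  - intros ([_ Uniq] & Qpsi & _ & x0 & Sx0 & P0 & Exp).
    pose proof hS as (S1 & Sadd & Sscal & Sstar).
    (* A functional in the ball takes at [s] the real part of its value at [x0], so exposedness
       passes to a self-adjoint element. *)
    set (s := re_part x0).
    assert (Hre : forall L, Q_sa_ball A S L -> L s = rc (Cre (L x0))).
    { intros L QL. apply Q_sa_ball_re_part with S; auto. }
    assert (Ps : psi s = C1) by (rewrite Hre, P0 by auto; reflexivity).
    assert (Hs : star s = s) by apply re_part_sa.
    exists s. split; [unfold s, re_part; auto|]. split; auto. split; [|split; auto].
    + apply Rle_antisym.
      (* If $\|s\| > 1$, a norming functional of [s] lies in the ball and its real part at [x0] is
         $\|s\|$, above the exposed value $1$. *)
      * apply Rnot_lt_le. intros Hlt.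
        destruct (norming_functional s) as (F & linF & Fs & Fle).
        assert (QL : Q_sa_ball A S (complexify F)).
        { pose proof (complexify_linear F linF) as Hlin. repeat split; intros.
          - apply Hlin.
          - apply Hlin.
          - apply complexify_star; auto.
          - apply hermitian_bound; auto.
            + intros; apply complexify_star; auto.
            + intros y Hy. rewrite complexify_sa by auto. apply Fle. }
        pose proof (Hre _ QL) as H. rewrite complexify_sa, Fs in H by auto.
        apply (f_equal Cre) in H. cbn [Cre rc] in H.
        assert (Cre (complexify F x0) < 1); [|lra].
        apply Exp; auto. intros E. rewrite (E x0 Sx0), P0 in H. lra.
      * pose proof (state_bound psi hpsi s) as H. rewrite Ps in H.
        change C1 with (rc 1) in H. rewrite Cabs_rc, Rabs_R1 in H. auto.
    + intros phi Hphi [a Ha]. pose proof (state_Q_sa_ball S phi Hphi) as Qphi.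
      rewrite Hre, Cabs_rc by auto. apply Rabs_def1.
      (* Agreement of [phi] with [psi] on [S] would give equality everywhere by unique extension. *)
      * apply Exp; auto. intros E. apply Ha, Uniq; auto. apply state_ucp; auto.
      (* The functional $-\phi$ is in the ball and differs from [psi] at [one], where the values are
         $-1$ and $1$. *)
      * assert (H : Cre (Copp (phi x0)) < 1).
        { apply (Exp (fun x => Copp (phi x))); [apply opp_Q_sa_ball; auto|].
          intros E. specialize (E one S1). cbv beta in E.
          rewrite (proj1 (proj2 Hphi)), (proj1 (proj2 hpsi)) in E.
          apply (f_equal Cre) in E. cbn in E. lra. }
        cbn in H. lra.
Qed.
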